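(* Let $(\mathfrak{A},\alpha)$ and $(\mathfrak{B},\beta)$ be $\mathbb{Z}_2$-graded $C^*$-algebras, with $\alpha=\mathrm{ad}_u$ for some selfadjoint unitary $u\in\mathfrak{A}$. The Klein transformation $\kappa_{\mathfrak{A},\mathfrak{B}}:\mathfrak{A}\otimes_F\mathfrak{B}\to\mathfrak{A}\otimes_X\mathfrak{B}$ is a $*$-isomorphism of $\mathfrak{A}\otimes_F\mathfrak{B}$ onto $\mathfrak{A}\otimes_X\mathfrak{B}$, whose transpose $\kappa_{\mathfrak{A},\mathfrak{B}}^{\rm t}$ (given by $\psi\mapsto\psi\circ\kappa_{\mathfrak{A},\mathfrak{B}}$) provides a bijective map between the even product states on $\mathfrak{A}\otimes_X\mathfrak{B}$ and the (even) product states on $\mathfrak{A}\otimes_F\mathfrak{B}$.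
   Context: All $C^*$-algebras are unital. A $\mathbb{Z}_2$-graded $C^*$-algebra $(\mathfrak{A},\alpha)$ is a $C^*$-algebra with a $*$-automorphism $\alpha$ satisfying $\alpha^2=\mathrm{id}$. Put $\mathfrak{A}_\pm=\{a:\alpha(a)=\pm a\}$ (even/odd, the homogeneous elements), so each $a$ decomposes as $a=a_++a_-$. A state $\varphi$ is even if $\varphi\circ\alpha=\varphi$; $\mathcal{S}_+(\mathfrak{A})$ is the set of even states. $\mathrm{ad}_u(a)=uau^*$. Fermi tensor product: on the algebraic tensor product $\mathfrak{A}\odot\mathfrak{B}$, for homogeneous elements put $\epsilon(x,y)=-1$ if $x$ and $y$ are both odd, $\epsilon(x,y)=1$ otherwise, and define product and involution by (bi)linear/antilinear extension of $(a\odot b)(a'\odot b')=\epsilon(b,a')\,aa'\odot bb'$ and $(a\odot b)^*=\epsilon(a,b)\,a^*\odot b^*$. For even states $\omega\in\mathcal{S}_+(\mathfrak{A})$, $\varphi\in\mathcal{S}_+(\mathfrak{B})$ the product functional $(\omega\times\varphi)(a\odot b)=\omega(a)\varphi(b)$ is a state on this $*$-algebra. The minimal norm is $\|x\|=\sup\{\|\pi_{\omega\times\varphi}(x)\|:\omega\in\mathcal{S}_+(\mathfrak{A}),\varphi\in\mathcal{S}_+(\mathfrak{B})\}$, with $\pi_{\omega\times\varphi}$ the GNS representation; $\mathfrak{A}\otimes_F\mathfrak{B}$ is the completion, $a\otimes_F b$ denotes the image of $a\odot b$, and $\omega\times\varphi$ also denotes the extended state. The (even) product states on $\mathfrak{A}\otimes_F\mathfrak{B}$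 are the states $\omega\times\varphi$ with $\omega,\varphi$ even. $\mathfrak{A}\otimes_X\mathfrak{B}$ is the usual minimal $C^*$-tensor product. The even product states on it are the states $\psi_{\omega,\varphi}$, $\psi_{\omega,\varphi}(a\otimes_X b)=\omega(a)\varphi(b)$, with $\omega\in\mathcal{S}_+(\mathfrak{A})$, $\varphi\in\mathcal{S}_+(\mathfrak{B})$. Klein transformation: when $\alpha=\mathrm{ad}_u$ with $u\in\mathfrak{A}$ a selfadjoint unitary, $\kappa_{\mathfrak{A},\mathfrak{B}}:\mathfrak{A}\otimes_F\mathfrak{B}\to\mathfrak{A}\otimes_X\mathfrak{B}$ is the continuous linear map determined by $$\kappa_{\mathfrak{A},\mathfrak{B}}\big(a\otimes_F b_+ +(au)\otimes_F b_-\big)=a\otimes_X b,\qquad a\in\mathfrak{A},\ b=b_++b_-\in\mathfrak{B}.$$ *)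

(* Defs.v *)
From HB Require Import structures.
From mathcomp Require Import all_boot all_order all_algebra.
From mathcomp Require Import generic_quotient complex.
From mathcomp Require Import boolp classical_sets functions reals ereal.
From mathcomp Require Import topology normedtype.

Set Implicit Arguments.
Unset Strict Implicit.
Unset Printing Implicit Defensive.

Import Order.TTheory GRing.Theory Num.Theory.
Import numFieldNormedType.Exports.

Local Open Scope classical_set_scope.
Local Open Scope ring_scope.

(* The norm of a normed module over R[i] is R[i]-valued; its values are
   nonnegative reals.  The ring structure is part of the mixin, and not
   inherited from GRing.Algebra, because a structure above both
   GRing.PzSemiRing and Num.SemiNormedZmodule would have to be declared before
   Num.NumDomain. *)
HB.mixin Record isCStarAlgebra (R : realType) A
    of CompleteNormedModule R[i] A := {
  cone : A ;
  cmul : A -> A -> A ;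
  star : A -> A ;
  cmulA : associative cmul ;
  cmul1x : left_id cone cmul ;
  cmulx1 : right_id cone cmul ;
  cmulDl : left_distributive cmul +%R ;
  cmulDr : right_distributive cmul +%R ;
  cone_neq0 : cone != 0 ;
  cscaleAl : forall (c : R[i]) x y, c *: cmul x y = cmul (c *: x) y ;
  cscaleAr : forall (c : R[i]) x y, c *: cmul x y = cmul x (c *: y) ;
  starD : {morph star : x y / x + y} ;
  starZ : forall (c : R[i]) x, star (c *: x) = c^* *: star x ;
  star_cmul : forall x y, star (cmul x y) = cmul (star y) (star x) ;
  starK : involutive star ;
  normr_cmul_le : forall x y, `|cmul x y| <= `|x| * `|y| ;
  normr_star_cmul : forall x, `|cmul (star x) x| = `|x| ^+ 2
}.

#[short(type="cstarAlgType")]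
HB.structure Definition CStarAlgebra (R : realType) :=
  { A of CompleteNormedModule R[i] A & isCStarAlgebra R A }.

HB.instance Definition _ (R : realType) (A : cstarAlgType R) :=
  GRing.Zmodule_isNzRing.Build A cmulA cmul1x cmulx1 cmulDl cmulDr cone_neq0.
HB.instance Definition _ (R : realType) (A : cstarAlgType R) :=
  GRing.LSemiModule_isLSemiAlgebra.Build R[i] A cscaleAl.
HB.instance Definition _ (R : realType) (A : cstarAlgType R) :=
  GRing.LSemiAlgebra_isSemiAlgebra.Build R[i] A cscaleAr.

(* The inner product is linear in its first argument. *)
HB.mixin Record isHilbert (R : realType) H
    of CompleteNormedModule R[i] H := {
  inner : {dot H for @Num.conj R[i]} ;
  sqr_normr_inner : forall v : H, `|v| ^+ 2 = inner v v
}.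

#[short(type="hilbertType")]
HB.structure Definition Hilbert (R : realType) :=
  { H of CompleteNormedModule R[i] H & isHilbert R H }.

Section TensorProduct.
Variables (K : comNzRingType) (U V : lmodType K).

(* Formal sums \sum_i u_i (x) v_i are lists of pairs; tens_rel is the least
   congruence making (u, v) |-> u (x) v bilinear. *)
Inductive tens_rel : seq (U * V) -> seq (U * V) -> Prop :=
| tens_refl s : tens_rel s s
| tens_sym s t : tens_rel s t -> tens_rel t s
| tens_trans s t r : tens_rel s t -> tens_rel t r -> tens_rel s r
| tens_cat s s' t t' :
    tens_rel s s' -> tens_rel t t' -> tens_rel (s ++ t) (s' ++ t')
| tens_comm s t : tens_rel (s ++ t) (t ++ s)
| tens_zero v : tens_rel [:: (0, v)] [::]
| tens_addl u u' v : tens_rel [:: (u + u', v)] [:: (u, v); (u', v)]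
| tens_addr u v v' : tens_rel [:: (u, v + v')] [:: (u, v); (u, v')]
| tens_scale c u v : tens_rel [:: (c *: u, v)] [:: (u, c *: v)].

Definition tens_eqb (s t : seq (U * V)) : bool := `[< tens_rel s t >].

Lemma tens_eqb_refl : reflexive tens_eqb.
Proof. by move=> s; apply/asboolP; exact: tens_refl. Qed.

Lemma tens_eqb_sym : symmetric tens_eqb.
Proof. by move=> s t; apply/asboolP/asboolP; exact: tens_sym. Qed.

Lemma tens_eqb_trans : transitive tens_eqb.
Proof.
by move=> t s r /asboolP st /asboolP tr; apply/asboolP; exact: tens_trans st tr.
Qed.

Canonical tens_equiv :=
  EquivRel tens_eqb tens_eqb_refl tens_eqb_sym tens_eqb_trans.

Local Open Scope quotient_scope.

Definition tensor := {eq_quot tens_equiv}.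
HB.instance Definition _ := Choice.on tensor.
HB.instance Definition _ := EqQuotient.on tensor.

Lemma tensor_indW (P : tensor -> Prop) :
  (forall s, P (\pi_tensor s)) -> forall x, P x.
Proof. by move=> Ppi x; rewrite -[x]reprK. Qed.

Definition tens (u : U) (v : V) : tensor := \pi_tensor [:: (u, v)].

Lemma tens_piP s t : tens_rel s t <-> \pi_tensor s = \pi_tensor t.
Proof.
split=> [st|]; first by apply/eqmodP/asboolP.
by move/eqmodP/asboolP.
Qed.

Lemma tens_repr s : tens_rel (repr (\pi_tensor s)) s.
Proof. by apply/tens_piP; rewrite reprK. Qed.

Definition tens_map_scale (c : K) (s : seq (U * V)) :=
  [seq (c *: p.1, p.2) | p <- s].

Lemma tens_map_scaleP c s t :
  tens_rel s t -> tens_rel (tens_map_scale c s) (tens_map_scale c t).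
Proof.
elim=> {s t} /=.
- by move=> s; exact: tens_refl.
- by move=> s t _; exact: tens_sym.
- by move=> s t r _ st _; exact: tens_trans.
- by move=> s s' t t' _ ss _ tt'; rewrite /tens_map_scale !map_cat;
    exact: tens_cat.
- by move=> s t; rewrite /tens_map_scale !map_cat; exact: tens_comm.
- by move=> v; rewrite scaler0; exact: tens_zero.
- by move=> u u' v; rewrite scalerDr; exact: tens_addl.
- by move=> u v v'; exact: tens_addr.
- by move=> d u v; rewrite scalerA mulrC -scalerA; exact: tens_scale.
Qed.

Definition tensor_add (x y : tensor) : tensor := \pi_tensor (repr x ++ repr y).
Definition tensor_zero : tensor := \pi_tensor [::].
Definition tensor_scale (c : K) (x : tensor) : tensor :=
  \pi_tensor (tens_map_scale c (repr x)).
Definition tensor_opp (x : tensor) : tensor := tensor_scale (-1) x.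

Lemma tensor_addE s t : tensor_add (\pi_tensor s) (\pi_tensor t) =
  \pi_tensor (s ++ t).
Proof. by apply/tens_piP; apply: tens_cat; exact: tens_repr. Qed.

Lemma tensor_scaleE c s :
  tensor_scale c (\pi_tensor s) = \pi_tensor (tens_map_scale c s).
Proof. by apply/tens_piP/tens_map_scaleP; exact: tens_repr. Qed.

Lemma tensor_addA : associative tensor_add.
Proof.
move=> x y z; elim/tensor_indW: x => s; elim/tensor_indW: y => t.
elim/tensor_indW: z => r.
by rewrite !tensor_addE catA.
Qed.

Lemma tensor_addC : commutative tensor_add.
Proof.
move=> x y; elim/tensor_indW: x => s; elim/tensor_indW: y => t.
rewrite !tensor_addE.
by apply/tens_piP; exact: tens_comm.
Qed.

Lemma tensor_add0 : left_id tensor_zero tensor_add.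
Proof. by move=> x; elim/tensor_indW: x => s; rewrite tensor_addE. Qed.

Lemma tensor_scaleDl x c d :
  tensor_scale (c + d) x = tensor_add (tensor_scale c x) (tensor_scale d x).
Proof.
elim/tensor_indW: x => s; rewrite !tensor_scaleE tensor_addE; apply/tens_piP.
elim: s => [|[u v] s IH] /=; first exact: tens_refl.
rewrite -cat1s scalerDl; apply: tens_trans (tens_cat (tens_addl _ _ _) IH) _.
apply: (@tens_cat [:: _] [:: _]); first exact: tens_refl.
rewrite -(cat1s _ (_ ++ _)) -(cat1s _ (tens_map_scale d s)) !catA.
exact: tens_cat (tens_comm _ _) (tens_refl _).
Qed.

Lemma tensor_scale0 x : tensor_scale 0 x = tensor_zero.
Proof.
elim/tensor_indW: x => s; rewrite tensor_scaleE; apply/tens_piP.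
elim: s => [|[u v] s IH] /=; first exact: tens_refl.
by rewrite scale0r -cat1s -[X in tens_rel _ X]cat0s;
   apply: tens_cat (tens_zero _) IH.
Qed.

Lemma tensor_scale1 : left_id 1 tensor_scale.
Proof.
move=> x; elim/tensor_indW: x => s; rewrite tensor_scaleE; congr (\pi_tensor _).
by rewrite -[RHS]map_id; apply: eq_map => -[u v] /=; rewrite scale1r.
Qed.

Lemma tensor_addN : left_inverse tensor_zero tensor_opp tensor_add.
Proof.
move=> x; rewrite -{2}[x]tensor_scale1 -tensor_scaleDl addNr.
exact: tensor_scale0.
Qed.

Lemma tensor_scaleA c d x :
  tensor_scale c (tensor_scale d x) = tensor_scale (c * d) x.
Proof.
elim/tensor_indW: x => s; rewrite !tensor_scaleE /tens_map_scale -map_comp.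
by congr (\pi_tensor _); apply: eq_map => -[u v] /=; rewrite scalerA.
Qed.

Lemma tensor_scaleDr : right_distributive tensor_scale tensor_add.
Proof.
move=> c x y; elim/tensor_indW: x => s; elim/tensor_indW: y => t.
by rewrite !(tensor_addE, tensor_scaleE) /tens_map_scale map_cat.
Qed.

HB.instance Definition _ := GRing.isZmodule.Build tensor
  tensor_addA tensor_addC tensor_add0 tensor_addN.
HB.instance Definition _ := GRing.Zmodule_isLmodule.Build K tensor
  tensor_scaleA tensor_scale1 tensor_scaleDr tensor_scaleDl.

Lemma tensDl u u' v : tens (u + u') v = tens u v + tens u' v.
Proof. by rewrite [RHS]tensor_addE; apply/tens_piP; exact: tens_addl. Qed.

Lemma tensDr u v v' : tens u (v + v') = tens u v + tens u v'.
Proof. by rewrite [RHS]tensor_addE; apply/tens_piP; exact: tens_addr. Qed.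

Lemma tensZl c u v : tens (c *: u) v = c *: tens u v.
Proof. by rewrite [RHS]tensor_scaleE. Qed.

Lemma tensZr c u v : tens u (c *: v) = c *: tens u v.
Proof. by rewrite -tensZl; apply/esym/tens_piP; exact: tens_scale. Qed.

Lemma tens0l v : tens 0 v = 0.
Proof. by rewrite -(scale0r (0 : U)) tensZl scale0r. Qed.

Lemma tens0r u : tens u 0 = 0.
Proof. by rewrite -(scale0r (0 : V)) tensZr scale0r. Qed.

Lemma pi_tensE s : \pi_tensor s = \sum_(p <- s) tens p.1 p.2.
Proof.
elim: s => [|[u v] s IH]; first by rewrite big_nil.
by rewrite big_cons -IH -cat1s -tensor_addE.
Qed.

Lemma tensorE (x : tensor) : x = \sum_(p <- repr x) tens p.1 p.2.
Proof. by rewrite -pi_tensE reprK. Qed.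

(* The extension of f to the tensor product.  It is the expected one when f is
   biadditive and f (c *: u) v = f u (c *: v), as in tlift_tens below. *)
Definition tlift (W : zmodType) (f : U -> V -> W) (x : tensor) : W :=
  \sum_(p <- repr x) f p.1 p.2.

Section Lift.
Variables (W : zmodType) (f : U -> V -> W).
Hypothesis fDl : forall u u' v, f (u + u') v = f u v + f u' v.
Hypothesis fDr : forall u v v', f u (v + v') = f u v + f u v'.
Hypothesis fZ : forall c u v, f (c *: u) v = f u (c *: v).

Lemma tlift_pi s : tlift f (\pi_tensor s) = \sum_(p <- s) f p.1 p.2.
Proof.
suff H s' t : tens_rel s' t ->
    \sum_(p <- s') f p.1 p.2 = \sum_(p <- t) f p.1 p.2 by exact/H/tens_repr.
elim=> {s s' t} //=.
- by move=> s t r _ -> _ ->.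
- by move=> s s' t t' _ e _ e'; rewrite !big_cat /= e e'.
- by move=> s t; rewrite !big_cat /= addrC.
- move=> v; rewrite big_seq1 big_nil /=.
  by apply: (addrI (f 0 v)); rewrite -fDl !addr0.
- by move=> u u' v; rewrite !big_cons !big_nil /= !addr0 fDl.
- by move=> u v v'; rewrite !big_cons !big_nil /= !addr0 fDr.
- by move=> c u v; rewrite !big_seq1 /= fZ.
Qed.

Lemma tlift_tens u v : tlift f (tens u v) = f u v.
Proof. by rewrite tlift_pi big_seq1. Qed.

Lemma tliftD : {morph tlift f : x y / x + y}.
Proof.
move=> x y; elim/tensor_indW: x => s; elim/tensor_indW: y => t.
rewrite [X in tlift f X]tensor_addE.
by rewrite !tlift_pi big_cat.
Qed.

End Lift.

Lemma tlift_linear (W : lmodType K) (f : U -> V -> W) :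
    (forall v, linear (f^~ v)) -> (forall u, linear (f u)) ->
  linear (tlift f) /\ forall u v, tlift f (tens u v) = f u v.
Proof.
move=> fl fr.
have fDl u u' v : f (u + u') v = f u v + f u' v.
  by have := fl v 1 u u'; rewrite /= !scale1r.
have fDr u v v' : f u (v + v') = f u v + f u v'.
  by have := fr u 1 v v'; rewrite /= !scale1r.
have f0l v : f 0 v = 0 by apply: (addrI (f 0 v)); rewrite -fDl !addr0.
have f0r u : f u 0 = 0 by apply: (addrI (f u 0)); rewrite -fDr !addr0.
have fZl c u v : f (c *: u) v = c *: f u v.
  by have := fl v c u 0; rewrite /= !addr0 f0l addr0.
have fZr c u v : f u (c *: v) = c *: f u v.
  by have := fr u c v 0; rewrite /= !addr0 f0r addr0.
have fZ c u v : f (c *: u) v = f u (c *: v) by rewrite fZl fZr.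
split; last exact: tlift_tens.
move=> c x y; rewrite tliftD //; congr (_ + _).
elim/tensor_indW: x => s; rewrite [X in tlift f X]tensor_scaleE !tlift_pi //.
by rewrite big_map scaler_sumr; apply: eq_bigr => p _; rewrite fZl.
Qed.

Lemma tensor_ext (W : zmodType) (f g : tensor -> W) :
    {morph f : x y / x + y} -> {morph g : x y / x + y} ->
  (forall u v, f (tens u v) = g (tens u v)) -> f =1 g.
Proof.
move=> fD gD fg.
have f0 : f 0 = 0 by apply: (addrI (f 0)); rewrite -fD !addr0.
have g0 : g 0 = 0 by apply: (addrI (g 0)); rewrite -gD !addr0.
move=> x; elim/tensor_indW: x => s; rewrite pi_tensE; elim: s => [|p s IH].
  by rewrite big_nil f0 g0.
by rewrite big_cons fD gD IH fg.
Qed.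

End TensorProduct.

Section Gradings.
Variable R : realType.
Implicit Types A B : cstarAlgType R.

Definition star_morphism A B (f : A -> B) : Prop :=
  [/\ linear f, {morph f : x y / x * y}, f 1 = 1
    & {morph f : x / star x}].

Definition star_isomorphism A B (f : A -> B) : Prop :=
  star_morphism f /\ bijective f.

Definition z2_grading A (alpha : A -> A) : Prop :=
  star_isomorphism alpha /\ involutive alpha.

Definition selfadjoint_unitary A (u : A) : Prop :=
  [/\ star u = u, star u * u = 1 & u * star u = 1].

Definition ad A (u a : A) : A := u * a * star u.

(* Parities are booleans, true standing for odd. *)
Definition homogeneous A (alpha : A -> A) (s : bool) : set A :=
  [set a | alpha a = (-1) ^+ s *: a].

Definition hpart A (alpha : A -> A) (s : bool) (a : A) : A :=
  2^-1 *: (a + (-1) ^+ s *: alpha a).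

Definition state A : set (A -> R[i]) :=
  [set w | [/\ scalar w, forall a, 0 <= w (star a * a) & w 1 = 1]].

Definition even_state A (alpha : A -> A) : set (A -> R[i]) :=
  [set w | @state A w /\ w \o alpha = w].

End Gradings.

Section StarAlgebraOnTensor.
Variables (R : realType) (A B : cstarAlgType R).
Local Notation T := (tensor A B).

(* The Fermi product and involution of general elementary tensors, obtained by
   splitting b, a' (resp. a, b) into homogeneous parts; see fermi_mulE and
   fermi_starE below. *)
Definition fermi_mul (alpha : A -> A) (beta : B -> B) (x y : T) : T :=
  tlift (fun a b => tlift (fun a' b' =>
    \sum_(s : bool) \sum_(t : bool) (-1) ^+ (s && t) *:
      tens (a * hpart alpha t a') (hpart beta s b * b')) y) x.

Definition fermi_star (alpha : A -> A) (beta : B -> B) (x : T) : T :=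
  tlift (fun a b =>
    \sum_(s : bool) \sum_(t : bool) (-1) ^+ (s && t) *:
      tens (star (hpart alpha s a)) (star (hpart beta t b))) x.

Definition tensor_mul (x y : T) : T :=
  tlift (fun a b => tlift (fun a' b' => tens (a * a') (b * b')) y) x.

Definition tensor_star (x : T) : T :=
  tlift (fun a b => tens (star a) (star b)) x.

Definition product_functional (w : A -> R[i]) (p : B -> R[i]) (x : T) : R[i] :=
  tlift (fun a b => w a * p b) x.

Lemma tlift_linear_fun (V W : lmodType R[i]) (f : V -> A -> B -> W) (x : T) :
  (forall a b, linear (fun v => f v a b)) -> linear (fun v => tlift (f v) x).
Proof.
move=> fl c v w; rewrite /tlift scaler_sumr -big_split /=.
by apply: eq_bigr => p _; exact: fl.
Qed.

Lemma linear_sum_sign (V W : lmodType R[i]) (f : bool -> bool -> V -> W) :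
    (forall s t, linear (f s t)) ->
  linear (fun v =>
    \sum_(s : bool) \sum_(t : bool) (-1) ^+ (s && t) *: f s t v).
Proof.
move=> fl c v w; rewrite scaler_sumr -big_split; apply: eq_bigr => s _ /=.
rewrite scaler_sumr -big_split; apply: eq_bigr => t _ /=.
by rewrite fl scalerDr !scalerA mulrC.
Qed.

Lemma hpart_linear (E : cstarAlgType R) (gam : E -> E) s :
  linear gam -> linear (hpart gam s).
Proof.
move=> gl c x y; rewrite /hpart gl [in RHS]scalerA mulrC -scalerA -scalerDr.
congr (_ *: _); rewrite !scalerDr !scalerA [c * _]mulrC.
by rewrite addrACA.
Qed.

Lemma hpart_homogeneous (E : cstarAlgType R) (gam : E -> E) s t a :
  homogeneous gam t a -> hpart gam s a = if s == t then a else 0.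
Proof.
rewrite /homogeneous /hpart /= => ->.
have two : 2^-1 *: (a + a) = a.
  transitivity ((2^-1 * (1 + 1) : R[i]) *: a).
    by rewrite -scalerA scalerDl scale1r.
  by rewrite -[1 + 1]/(2%:R) mulVf ?scale1r // pnatr_eq0.
by case: s t => -[]; rewrite ?expr1 ?expr0 ?scale1r ?scaleN1r ?opprK // subrr
  scaler0.
Qed.

Lemma sum_sign_homogeneous (W : lmodType R[i]) (f : bool -> bool -> W) s t :
    (forall s' t', (s', t') != (s, t) -> f s' t' = 0) ->
  \sum_(s' : bool) \sum_(t' : bool) (-1) ^+ (s' && t') *: f s' t' =
  (-1) ^+ (s && t) *: f s t :> W.
Proof.
move=> f0; rewrite (bigD1 s) //= (bigD1 t) //= !big1 ?addr0 //.
  move=> s' ss'; rewrite big1 // => t' _.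
  by rewrite f0 ?scaler0 // xpair_eqE negb_and ss'.
by move=> t' tt'; rewrite f0 ?scaler0 // xpair_eqE negb_and tt' orbT.
Qed.

Section Fermi.
Variables (alpha : A -> A) (beta : B -> B).
Hypotheses (alphaG : z2_grading alpha) (betaG : z2_grading beta).

Let alpha_lin : linear alpha. Proof. by case: alphaG => -[[]]. Qed.
Let beta_lin : linear beta. Proof. by case: betaG => -[[]]. Qed.

Let term s t a b a' b' : T :=
  tens (a * hpart alpha t a') (hpart beta s b * b').

Let term1 s t b a' b' : linear (fun a => term s t a b a' b').
Proof. by move=> c x y; rewrite /term mulrDl tensDl -(scalerAl c) tensZl. Qed.
Let term2 s t a a' b' : linear (fun b => term s t a b a' b').
Proof.
move=> c x y.
by rewrite /term hpart_linear // mulrDl tensDr -(scalerAl c) tensZr.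
Qed.
Let term3 s t a b b' : linear (fun a' => term s t a b a' b').
Proof.
move=> c x y.
by rewrite /term hpart_linear // mulrDr tensDl -(scalerAr c) tensZl.
Qed.
Let term4 s t a b a' : linear (fun b' => term s t a b a' b').
Proof. by move=> c x y; rewrite /term mulrDr tensDr -(scalerAr c) tensZr. Qed.

Lemma fermi_mul_linearl y : linear (fun x => fermi_mul alpha beta x y).
Proof.
apply: (proj1 (tlift_linear _ _)) => [b|a]; apply: tlift_linear_fun => a' b'.
  by apply: linear_sum_sign => s t; exact: term1.
by apply: linear_sum_sign => s t; exact: term2.
Qed.

Lemma fermi_mul_linearr x : linear (fermi_mul alpha beta x).
Proof.
apply: tlift_linear_fun => a b; apply: (proj1 (tlift_linear _ _)) => [b'|a'].
  by apply: linear_sum_sign => s t; exact: term3.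
by apply: linear_sum_sign => s t; exact: term4.
Qed.

Lemma fermi_mul_tens a b a' b' :
  fermi_mul alpha beta (tens a b) (tens a' b') =
  \sum_(s : bool) \sum_(t : bool) (-1) ^+ (s && t) *:
    tens (a * hpart alpha t a') (hpart beta s b * b').
Proof.
rewrite /fermi_mul (proj2 (tlift_linear _ _)).
- apply: (proj2 (tlift_linear _ _)) => [v|v].
    by apply: linear_sum_sign => s t; exact: term3.
  by apply: linear_sum_sign => s t; exact: term4.
- move=> v; apply: tlift_linear_fun => x y.
  by apply: linear_sum_sign => s t; exact: term1.
- move=> v; apply: tlift_linear_fun => x y.
  by apply: linear_sum_sign => s t; exact: term2.
Qed.

Lemma fermi_mulE s t a b a' b' :
    homogeneous beta s b -> homogeneous alpha t a' ->
  fermi_mul alpha beta (tens a b) (tens a' b') =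
  (-1) ^+ (s && t) *: tens (a * a') (b * b').
Proof.
move=> bs at_; rewrite fermi_mul_tens.
rewrite (@sum_sign_homogeneous _ _ s t) => [|s' t'].
  by rewrite (hpart_homogeneous _ bs) (hpart_homogeneous _ at_) !eqxx.
rewrite (hpart_homogeneous _ bs) (hpart_homogeneous _ at_) xpair_eqE negb_and.
case: eqP => _ /=; last by rewrite mul0r tens0r.
by move=> /negPf ->; rewrite mulr0 tens0l.
Qed.

Let sterm a b : T :=
  \sum_(s : bool) \sum_(t : bool) (-1) ^+ (s && t) *:
      tens (star (hpart alpha s a)) (star (hpart beta t b)).

Let stermDl a a' b : sterm (a + a') b = sterm a b + sterm a' b.
Proof.
rewrite -big_split; apply: eq_bigr => s _; rewrite -big_split.
apply: eq_bigr => t _ /=.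
have := hpart_linear s alpha_lin 1 a a'; rewrite !scale1r => ->.
by rewrite starD tensDl scalerDr.
Qed.
Let stermDr a b b' : sterm a (b + b') = sterm a b + sterm a b'.
Proof.
rewrite -big_split; apply: eq_bigr => s _; rewrite -big_split.
apply: eq_bigr => t _ /=.
have := hpart_linear t beta_lin 1 b b'; rewrite !scale1r => ->.
by rewrite starD tensDr scalerDr.
Qed.
Let hpartZ (E : cstarAlgType R) (gam : E -> E) s c x : linear gam ->
  hpart gam s (c *: x) = c *: hpart gam s x.
Proof.
move=> gl; have h0 : hpart gam s 0 = 0.
  have := hpart_linear s gl 1 0 0; rewrite !scale1r addr0 => h.
  by apply: (addrI (hpart gam s 0)); rewrite -h addr0.
by have := hpart_linear s gl c x 0; rewrite h0 !addr0.
Qed.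
Let stermZl c a b : sterm (c *: a) b = c^* *: sterm a b.
Proof.
rewrite scaler_sumr; apply: eq_bigr => s _.
rewrite scaler_sumr; apply: eq_bigr => t _.
by rewrite hpartZ // (starZ c) tensZl !scalerA mulrC.
Qed.
Let stermZr c a b : sterm a (c *: b) = c^* *: sterm a b.
Proof.
rewrite scaler_sumr; apply: eq_bigr => s _.
rewrite scaler_sumr; apply: eq_bigr => t _.
by rewrite hpartZ // (starZ c) tensZr !scalerA mulrC.
Qed.
Let stermZ c a b : sterm (c *: a) b = sterm a (c *: b).
Proof. by rewrite stermZl stermZr. Qed.

Lemma fermi_starE s t a b :
    homogeneous alpha s a -> homogeneous beta t b ->
  fermi_star alpha beta (tens a b) =
  (-1) ^+ (s && t) *: tens (star a) (star b).
Proof.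
move=> as_ bt; rewrite /fermi_star (tlift_tens stermDl stermDr stermZ).
have star0 (E : cstarAlgType R) : star (0 : E) = 0.
  by apply: (addrI (star 0)); rewrite -starD !addr0.
rewrite /sterm (@sum_sign_homogeneous _ _ s t) => [|s' t'].
  by rewrite (hpart_homogeneous _ as_) (hpart_homogeneous _ bt) !eqxx.
rewrite (hpart_homogeneous _ as_) (hpart_homogeneous _ bt) xpair_eqE negb_and.
case: eqP => _ /=; last by rewrite star0 tens0l.
by move=> /negPf ->; rewrite star0 tens0r.
Qed.

Lemma fermi_starD : {morph fermi_star alpha beta : x y / x + y}.
Proof. exact: tliftD stermDl stermDr stermZ. Qed.

Lemma fermi_starZ c x :
  fermi_star alpha beta (c *: x) = c^* *: fermi_star alpha beta x.
Proof.
apply: (@tensor_ext _ A B T (fun x => fermi_star alpha beta (c *: x))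
  (fun x => c^* *: fermi_star alpha beta x)) => [y z|y z|a b].
- by rewrite scalerDr fermi_starD.
- by rewrite fermi_starD scalerDr.
- by rewrite -tensZl /fermi_star !(tlift_tens stermDl stermDr stermZ) -stermZl.
Qed.

End Fermi.

Lemma tensor_mulE a b a' b' :
  tensor_mul (tens a b) (tens a' b') = tens (a * a') (b * b').
Proof.
rewrite /tensor_mul (proj2 (tlift_linear _ _)).
- apply: (proj2 (tlift_linear _ _)) => [?|?] c x y.
    by rewrite mulrDr tensDl -(scalerAr c) tensZl.
  by rewrite mulrDr tensDr -(scalerAr c) tensZr.
- move=> v; apply: tlift_linear_fun => ? ? c x y.
  by rewrite mulrDl tensDl -(scalerAl c) tensZl.
- move=> v; apply: tlift_linear_fun => ? ? c x y.
  by rewrite mulrDl tensDr -(scalerAl c) tensZr.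
Qed.

Lemma tensor_starE a b : tensor_star (tens a b) = tens (star a) (star b).
Proof.
apply: (tlift_tens (f := fun a b => tens (star a) (star b)))
  => [a1 a2 b1|a1 b1 b2|c a1 b1].
- by rewrite starD tensDl.
- by rewrite starD tensDr.
- by rewrite !starZ tensZl tensZr.
Qed.

Lemma product_functionalE w p a b : scalar w -> scalar p ->
  product_functional w p (tens a b) = w a * p b.
Proof.
move=> wl pl; pose f (x : A) (y : B) : R[i]^o := w x * p y.
apply: (proj2 (@tlift_linear _ A B R[i]^o f _ _)) => [z|z] c x y.
  by rewrite /f wl mulrDl -mulrA.
by rewrite /f pl mulrDr mulrCA.
Qed.

End StarAlgebraOnTensor.

Section GNS.
Variables (R : realType) (D : lmodType R[i]).
Variables (mul : D -> D -> D) (inv : D -> D).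

(* (H, pi, xi) is a GNS triple of psi on the *-algebra (D, mul, inv). *)
Record is_GNS (psi : D -> R[i]) (H : hilbertType R) (pi : D -> H -> H)
    (xi : H) : Prop := IsGNS {
  gns_linear : forall x, linear (pi x) ;
  gns_continuous : forall x, continuous (pi x) ;
  gns_lin : forall c x y v, pi (c *: x + y) v = c *: pi x v + pi y v ;
  gns_mul : forall x y v, pi (mul x y) v = pi x (pi y v) ;
  gns_star : forall x v w, inner (pi x v) w = inner v (pi (inv x) w) ;
  gns_cyclic : dense [set pi x xi | x in setT] ;
  gns_vector : forall x, psi x = inner (pi x xi) xi
}.

Definition opnorm (H : hilbertType R) (f : H -> H) : \bar R :=
  ereal_sup [set (complex.Re `|f v|)%:E | v in [set v : H | `|v| <= 1]].

(* The supremum of the norms of the GNS representations of S. *)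
Definition gns_sup (S : set (D -> R[i])) (x : D) : \bar R :=
  ereal_sup [set r | exists psi (H : hilbertType R) pi xi,
    [/\ S psi, @is_GNS psi H pi xi & r = opnorm (pi x)]].

(* j : D -> F exhibits F as the completion of (D, mul, inv) for the C*-norm
   nrm. *)
Record is_cstar_completion (nrm : D -> \bar R) (F : cstarAlgType R)
    (j : D -> F) : Prop := IsCStarCompletion {
  completion_linear : linear j ;
  completion_mul : forall x y, j (mul x y) = j x * j y ;
  completion_star : forall x, j (inv x) = star (j x) ;
  completion_norm : forall x, (complex.Re `|j x|)%:E = nrm x ;
  completion_dense : dense (range j)
}.

End GNS.

Section TensorNorms.
Variables (R : realType) (A B : cstarAlgType R).
Variables (alpha : A -> A) (beta : B -> B).

Definition fermi_norm : tensor A B -> \bar R :=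
  gns_sup (fermi_mul alpha beta) (fermi_star alpha beta)
    [set product_functional w p | w in even_state alpha & p in even_state beta].

Definition min_norm : tensor A B -> \bar R :=
  gns_sup (@tensor_mul R A B) (@tensor_star R A B)
    [set product_functional w p | w in @state R A & p in @state R B].

Definition is_fermi_tensor (F : cstarAlgType R) (j : tensor A B -> F) : Prop :=
  is_cstar_completion (fermi_mul alpha beta) (fermi_star alpha beta)
    fermi_norm j.

Definition is_min_tensor (X : cstarAlgType R) (j : tensor A B -> X) : Prop :=
  is_cstar_completion (@tensor_mul R A B) (@tensor_star R A B) min_norm j.

Definition even_product_state (F : cstarAlgType R) (j : tensor A B -> F) :
    set (F -> R[i]) :=
  [set psi | @state R F psi /\ exists w p,
    [/\ even_state alpha w, even_state beta p
      & forall a b, psi (j (tens a b)) = w a * p b]].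

Definition is_klein (u : A) (F X : cstarAlgType R)
    (jF : tensor A B -> F) (jX : tensor A B -> X) (kappa : F -> X) : Prop :=
  [/\ linear kappa, continuous kappa & forall a b,
    kappa (jF (tens a (hpart beta false b)) +
           jF (tens (a * u) (hpart beta true b))) = jX (tens a b)].

End TensorNorms.

(* Main.v *)
Require Import Defs.
From HB Require Import structures.
From mathcomp Require Import all_boot all_order all_algebra.
From mathcomp Require Import complex.
From mathcomp Require Import boolp classical_sets functions reals ereal.
From mathcomp Require Import topology normedtype.
From mathcomp Require Import ring lra.
Set Implicit Arguments.
Unset Strict Implicit.
Unset Printing Implicit Defensive.

Import Order.TTheory GRing.Theory Num.Theory.
Import numFieldNormedType.Exports.

Local Open Scope classical_set_scope.
Local Open Scope ring_scope.

(** The map k sending a (x) b, with b homogeneous of parity t, to a u^t (x) b is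
    a *-isomorphism from the Fermi *-algebra onto the tensor product *-algebra.
    It leaves even product functionals invariant, so it carries
    the Fermi norm to the supremum of the GNS norms over the even product states
    of the usual tensor product; this is at most the minimal norm, where all
    product states enter.  For the converse, a product state w (x) p is
    dominated by 4 times the even product state of the averages of w and p
    under the gradings.  The GNS representation of the latter lives on the
    closed cyclic subspace of H^4, where H carries the GNS representation of
    w (x) p twisted by the four automorphisms alpha^s (x) beta^t; and a
    representation dominated by another one has a smaller norm.  Hence k is
    isometric and extends to the completions. *)

(** * Linear maps and inner products *)

Section LinearMaps.
Variables (K : nzRingType) (U V : lmodType K) (f : U -> V).
Hypothesis f_linear : linear f.

Lemma linear_morph0 : f 0 = 0.
Proof. by have := zmod_morphism_linear f_linear 0 0; rewrite !subrr. Qed.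

Lemma linear_morphD : {morph f : x y / x + y}.
Proof. by move=> x y; rewrite -{1}[x]scale1r f_linear scale1r. Qed.
End LinearMaps.

Section Inner.
Variables (C : numClosedFieldType) (V : lmodType C).
Variable form : {dot V for @Num.conj C}.

Lemma dot_cauchy_schwarz (u v : V) :
  `|form u v| <= sqrtC (form u u) * sqrtC (form v v).
Proof.
have [->|v0] := eqVneq v 0; first by rewrite !linear0r normr0 sqrtC0 mulr0.
rewrite -ler_sqr ?nnegrE ?mulr_ge0 ?sqrt_dnorm_ge0 // exprMn !sqrtCK.
(* [w] is the component of [u] orthogonal to [v]; the inequality is what Pythagoras leaves after
   dropping the term of [w]. *)
pose a := form u v / form v v; pose w := u - a *: v.
have wv : form w v = 0.
  by rewrite linearBl linearZl_LR /= divfK ?dnorm_eq0 // subrr.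
have -> : form u u = form w w + `|a| ^+ 2 * form v v.
  by rewrite -dnormZ -hnormDd ?subrK // linearZr_LR /= wv mulr0.
have -> : form u v = a * form v v by rewrite divfK ?dnorm_eq0.
rewrite normrM exprMn (ger0_norm (dnorm_ge0 _ _)) expr2 mulrDl mulrA lerDr.
by rewrite mulr_ge0 ?dnorm_ge0.
Qed.

Lemma sqrt_dnormD (u v : V) :
  sqrtC (form (u + v) (u + v)) <= sqrtC (form u u) + sqrtC (form v v).
Proof.
rewrite -ler_sqr ?nnegrE ?addr_ge0 ?sqrt_dnorm_ge0 // sqrrD !sqrtCK.
rewrite dnormD addrAC lerD2r lerD2l.
have fr : form u v + (form u v)^* \is Num.real.
  by rewrite CrealE rmorphD /= conjCK addrC.
apply: le_trans (real_ler_norm fr) _; apply: le_trans (ler_normD _ _) _.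
by rewrite norm_conjC -mulr2n lerMn2r dot_cauchy_schwarz.
Qed.

Lemma sqrt_dnormZ (a : C) (u : V) :
  sqrtC (form (a *: u) (a *: u)) = `|a| * sqrtC (form u u).
Proof.
by rewrite dnormZ rootCMl ?exprn_ge0 // sqrCK.
Qed.
End Inner.

Section HilbertNorm.
Variables (R : realType) (H : hilbertType R).
Implicit Types v w : H.

Lemma normr_inner v : `|v| = sqrtC (inner v v).
Proof. by rewrite -sqr_normr_inner sqrCK. Qed.

Lemma normr_inner_le v w : `|inner v w| <= `|v| * `|w|.
Proof. by rewrite !normr_inner; exact: dot_cauchy_schwarz. Qed.

Lemma inner_conj v w : inner v w = (inner w v)^*.
Proof. by rewrite (hermC (inner : {dot H for _})) expr0 mul1r. Qed.
End HilbertNorm.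

(** * Growth of log-convex sequences *)

(** Log-convexity makes the ratios of consecutive terms nondecreasing. If the first ratio r exceeded
    L, the sequence would grow at least like r ^ n, which eventually beats every multiple of L ^
    n. *)
Lemma logconvex_growth (R : archiRealFieldType) (a : nat -> R) (L c : R) :
    (forall n, 0 <= a n) -> (forall n, a n.+1 ^+ 2 <= a n.+2 * a n) ->
    0 <= L -> (forall n, a n <= c * L ^+ n) ->
  a 1%N <= L * a 0%N.
Proof.
move=> a_ge0 a_lc L_ge0 aL; rewrite leNgt; apply/negP => La.
have a0 : 0 < a 0%N.
  (* If [a 0] vanished, log-convexity would force [a 1] to vanish too, against [La]. *)
  rewrite lt0r a_ge0 andbT; apply/eqP => a00.
  move: (a_lc 0%N) La; rewrite a00 !mulr0 exprn_even_le0 //= => /eqP ->.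
  by rewrite ltxx.
set r := a 1%N / a 0%N.
have Lr : L < r by rewrite ltr_pdivlMr.
have r0 : 0 < r by exact: le_lt_trans Lr.
have step n : 0 < a n /\ r * a n <= a n.+1.
  elim: n => [|n [an IH]]; first by rewrite divfK ?gt_eqF.
  have an1 : 0 < a n.+1 by apply: lt_le_trans IH; rewrite mulr_gt0.
  split=> //; rewrite -(ler_pM2r an); apply: le_trans (a_lc n).
  by rewrite expr2 mulrAC ler_wpM2r // ltW.
have geo n : r ^+ n * a 0%N <= a n.
  elim: n => [|n IH]; first by rewrite mul1r.
  by rewrite exprS -mulrA; apply: le_trans (step n).2; rewrite ler_pM2l.
(* The comparison below divides by [L]. For L = 0 the growth bound already contradicts the
   positivity of [a 1]. *)
have [L0|L0] := eqVneq L 0.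
  move: (aL 1%N) (step 1%N).1; rewrite L0 expr1 mulr0 => /le_lt_trans h /h.
  by rewrite ltxx.
have Lgt : 0 < L by rewrite lt0r L0.
pose d := r / L - 1.
have d0 : 0 < d by rewrite subr_gt0 ltr_pdivlMr // mul1r.
(* Bernoulli's inequality: the quotient of the two growth rates is at least linear in n. *)
have bern n : 1 + n%:R * d <= (r / L) ^+ n.
  elim: n => [|n IH]; first by rewrite mul0r addr0.
  have rL : r / L = 1 + d by rewrite addrC subrK.
  rewrite exprS {1}rL; apply: le_trans (_ : (1 + d) * (1 + n%:R * d) <= _).
    have := mulr_ge0 (ler0n R n) (sqr_ge0 d); rewrite -natr1; nra.
  by rewrite ler_pM2l // addr_gt0.
have bound n : n%:R * d * a 0%N <= c.
  apply: le_trans (_ : (r / L) ^+ n * a 0%N <= _).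
    by rewrite ler_pM2r //; apply: le_trans (bern n); rewrite lerDr.
  rewrite expr_div_n mulrAC ler_pdivrMr ?exprn_gt0 //.
  exact: le_trans (geo n) (aL n).
have da : 0 < d * a 0%N by rewrite mulr_gt0.
pose N := Num.bound (c / (d * a 0%N)).
have c0 : 0 <= c by move: (bound 0%N); rewrite !mul0r.
have := archi_boundP (divr_ge0 c0 (ltW da)).
by rewrite ltr_pdivrMr // ltNge mulrA bound.
Qed.

(** * Norm estimates with values in R[i] *)

Section ComplexNorm.
Variable R : realType.
Implicit Types x y : R[i].

Lemma Re_le x y : x <= y -> complex.Re x <= complex.Re y.
Proof. by rewrite lecE => /andP[]. Qed.

Lemma ge0_Re x : 0 <= x -> ((complex.Re x)%:C)%C = x.
Proof. by move=> x0; rewrite RRe_real // ger0_real. Qed.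

Lemma le_Re x y : 0 <= x -> 0 <= y -> complex.Re x <= complex.Re y -> x <= y.
Proof. by move=> x0 y0; rewrite -lecR !ge0_Re. Qed.

Lemma ReM_ge0 x y : 0 <= x -> 0 <= y ->
  complex.Re (x * y) = complex.Re x * complex.Re y.
Proof. by move=> /ge0_Re <- /ge0_Re <-; rewrite -rmorphM. Qed.

(** The order on R[i] is only partial, but positive elements are real and hence comparable. This
    merges two radii into one. *)
Lemma exists_gt0_min x y : 0 < x -> 0 < y ->
  exists z : R[i], [/\ 0 < z, z <= x & z <= y].
Proof.
move=> x0 y0; have /orP[le|le] := real_leVge (gtr0_real x0) (gtr0_real y0).
  by exists x.
by exists y.
Qed.

Lemma ReX_ge0 x n : 0 <= x -> complex.Re (x ^+ n) = complex.Re x ^+ n.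
Proof. by move=> /ge0_Re <-; rewrite -rmorphXn. Qed.
End ComplexNorm.

Section NormDense.
Variables (R : realType) (V : normedModType R[i]).

Lemma dense_norm (S : set V) : dense S ->
  forall v (e : R[i]), 0 < e -> exists2 s, S s & `|v - s| < e.
Proof.
move=> dS v e e0; have [] := dS (ball v e).
- by exists v; exact: ballxx.
- exact: ball_open.
by move=> s [vs Ss]; exists s => //; move: vs; rewrite -ball_normE.
Qed.

Lemma norm_dense (S : set V) :
    (forall v (e : R[i]), 0 < e -> exists2 s, S s & `|v - s| < e) -> dense S.
Proof.
move=> dS O [v Ov] oO; have := open_nbhs_nbhs (conj oO Ov).
move=> /nbhs_ballP[e e0 vO]; have [s Ss vs] := dS v e e0.
by exists s; split=> //; apply: vO; rewrite -ball_normE.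
Qed.
End NormDense.

Section OpNorm.
Variables (R : realType) (H : hilbertType R) (f : H -> H).

Lemma opnorm_le (M : R[i]) : 0 <= M -> (forall v, `|f v| <= M * `|v|) ->
  (opnorm f <= (complex.Re M)%:E)%E.
Proof.
move=> M0 fM; apply: ge_ereal_sup => _ [v /= v1 <-].
rewrite lee_fin; apply: Re_le; apply: le_trans (fM v) _.
by rewrite ler_piMr.
Qed.

Lemma le_opnorm (M : R[i]) : linear f -> 0 <= M ->
  (opnorm f <= (complex.Re M)%:E)%E -> forall v, `|f v| <= M * `|v|.
Proof.
move=> fl M0 fM v.
have [->|v0] := eqVneq v 0; first by rewrite linear_morph0 // !normr0 mulr0.
have nv : 0 < `|v| by rewrite normr_gt0.
rewrite -ler_pdivrMr // mulrC.
have -> : `|v|^-1 * `|f v| = `|f (`|v|^-1 *: v)|.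
  by rewrite (scalable_linear fl) normrZ ger0_norm // invr_ge0.
apply: le_Re => //; rewrite -lee_fin; apply: le_trans fM.
apply: ereal_sup_ubound; exists (`|v|^-1 *: v) => //=.
by rewrite normfZV.
Qed.

Lemma continuous_norm_le_dense (S : set H) (M : R[i]) :
    continuous f -> linear f -> dense S -> 0 <= M ->
  (forall v, S v -> `|f v| <= M * `|v|) -> forall v, `|f v| <= M * `|v|.
Proof.
move=> fc fl dS M0 fM v; apply/ler_addgt0Pr => e e0.
have e2 : 0 < e / 2 by rewrite divr_gt0.
(* A radius whose multiple by [M] stays below e / 2; adding 1 covers M = 0. *)
have eM : 0 < e / 2 / (M + 1) by rewrite divr_gt0 // ltr_wpDl.
have := fc v => /cvgrPdist_lt/(_ _ e2)/nbhs_ballP[d /= d0 vd].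
have [k [k0 kd ke]] := exists_gt0_min d0 eM.
have [s Ss vs] := dense_norm dS v k0.
have fvs : `|f v - f s| < e / 2.
  by apply: vd; rewrite -ball_normE; exact: lt_le_trans vs kd.
rewrite -(subrK (f s) (f v)); apply: le_trans (ler_normD _ _) _.
apply: le_trans (lerD (ltW fvs) (fM _ Ss)) _.
have sv : `|s| <= `|v| + e / 2 / (M + 1).
  rewrite -(subrK v s) addrC; apply: le_trans (ler_normD _ _) _.
  by rewrite lerD2l distrC; apply: ltW; exact: lt_le_trans vs ke.
have Me : M * (e / 2 / (M + 1)) <= e / 2.
  rewrite mulrCA ler_piMr ?ltW // ltr_pdivrMr ?ltr_wpDl // mul1r.
  by rewrite ltrDl.
apply: le_trans (lerD (lexx _) (ler_wpM2l M0 sv)) _.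
rewrite mulrDr addrCA lerD2l [leRHS]splitr lerD2l //.
Qed.
End OpNorm.

(** * Comparison of dominated GNS representations *)

Section Domination.
Variables (R : realType) (D : lmodType R[i]) (mul : D -> D -> D) (inv : D -> D).
Variables (psi : D -> R[i]) (H : hilbertType R) (pi : D -> H -> H) (xi : H).
Hypothesis G : is_GNS mul inv psi pi xi.

(** Conjugating [gns_star] exchanges the two arguments; this stands in for the identity
    [inv (inv x) = x]. *)
Lemma gns_adjoint x v w : inner (pi (inv x) v) w = inner v (pi x w).
Proof. by rewrite inner_conj -(gns_star G) -inner_conj. Qed.

Variables (psi' : D -> R[i]) (K : hilbertType R) (pi' : D -> K -> K) (xi' : K).
Hypothesis G' : is_GNS mul inv psi' pi' xi'.
Variables (c : R[i]) (N : D -> R[i]).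
Hypotheses (c_ge0 : 0 <= c) (N_ge0 : forall x, 0 <= N x).
Hypothesis N_cstar : forall x, N (mul (inv x) x) = N x ^+ 2.
Hypothesis dom : forall x, `|pi x xi| <= c * `|pi' x xi'|.

(* With S = pi (x^* x), the sequence |S^n v| is log-convex and grows at most
   like N (x^* x) ^ n, whence |S v| <= N (x^* x) |v|: the constant c is lost. *)
Lemma gns_dominated : (forall x v, `|pi' x v| <= N x * `|v|) ->
  forall x v, `|pi x v| <= N x * `|v|.
Proof.
move=> pi'N x; apply: continuous_norm_le_dense (gns_cyclic G) (N_ge0 x) _.
- exact: gns_continuous G x.
- exact: gns_linear G x.
move=> _ [y _ <-]; set v := pi y xi; pose z := mul (inv x) x.
have zE w : pi z w = pi (inv x) (pi x w) by exact: gns_mul G _ _ _.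
have zsym u w : inner (pi z u) w = inner u (pi z w).
  by rewrite !zE gns_adjoint (gns_star G).
pose a n := complex.Re `|iter n (pi z) v|.
(* [dom] compares only the orbits of the two cyclic vectors, so S^n v has to be exhibited as an
   orbit vector. *)
have aE n : iter n (pi z) v = pi (iter n (mul z) y) xi.
  by elim: n => //= n ->; rewrite (gns_mul G).
have pi'E n : `|pi' (iter n (mul z) y) xi'| <= N z ^+ n * `|pi' y xi'|.
  elim: n => [|n IH] /=; first by rewrite mul1r.
  rewrite (gns_mul G') exprS -mulrA; apply: le_trans (pi'N _ _) _.
  by rewrite ler_wpM2l.
have a_ge0 n : 0 <= a n by rewrite /a -ler0c ge0_Re.
have a_lc n : a n.+1 ^+ 2 <= a n.+2 * a n.
  rewrite -ReX_ge0 // -ReM_ge0 //; apply: Re_le.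
  rewrite -[leLHS]ger0_norm ?exprn_ge0 // sqr_normr_inner /= zsym mulrC.
  exact: normr_inner_le.
have aL n : a n <= complex.Re (c * `|pi' y xi'|) * complex.Re (N z) ^+ n.
  rewrite -ReX_ge0 // -ReM_ge0 ?mulr_ge0 ?exprn_ge0 //; apply: Re_le.
  rewrite aE; apply: le_trans (dom _) _.
  by rewrite -mulrA ler_wpM2l // mulrC.
have Nz0 : 0 <= complex.Re (N z) by rewrite -ler0c ge0_Re.
have := logconvex_growth a_ge0 a_lc Nz0 aL.
rewrite -ReM_ge0 //= => /(le_Re (normr_ge0 _) (mulr_ge0 (N_ge0 z) (normr_ge0 _))).
rewrite N_cstar => zv.
(* The square of |pi x v| is the inner product of v with S v, so Cauchy-Schwarz and the bound on S v
   finish. *)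
rewrite -ler_sqr ?nnegrE ?mulr_ge0 // exprMn -[leLHS]ger0_norm ?exprn_ge0 //.
rewrite sqr_normr_inner -gns_adjoint -zE; apply: le_trans (normr_inner_le _ _) _.
by rewrite [`|v| ^+ 2]expr2 mulrA ler_wpM2r.
Qed.
End Domination.

(** * Closed subspaces of finite Hilbert sums *)

Section DirectSum.
Variables (R : realType) (D : lmodType R[i]) (H : hilbertType R) (I : finType).

(* The closure in H^I of the range of x |-> (g i x)_i. *)
Definition range_closure (g : I -> {linear D -> H}) : {pred {ffun I -> H}} :=
  fun v => `[< forall e : R[i], 0 < e -> exists x, forall i, `|v i - g i x| < e >].

Lemma range_closureP (g : I -> {linear D -> H}) (v : {ffun I -> H}) :
  reflect (forall e : R[i], 0 < e -> exists x, forall i, `|v i - g i x| < e)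
    (v \in range_closure g).
Proof. exact: asboolP. Qed.

Variable g : I -> {linear D -> H}.

Lemma range_closure_submod : submod_closed (range_closure g).
Proof.
split.
  apply/range_closureP => e e0; exists 0 => i.
  by rewrite ffunE linear0 subrr normr0.
move=> c v w /range_closureP vg /range_closureP wg; apply/range_closureP => e e0.
have c1 : 0 < `|c| + 1 by rewrite ltr_wpDl.
have [x vx] := vg (e / 2 / (`|c| + 1)) (divr_gt0 (divr_gt0 e0 (ltr0n _ 2)) c1).
have [y wy] := wg (e / 2) (divr_gt0 e0 (ltr0n _ 2)).
exists (c *: x + y) => i; rewrite !ffunE linearP opprD addrACA -scalerBr.
apply: le_lt_trans (ler_normD _ _) _; rewrite [ltRHS]splitr normrZ.
rewrite ler_ltD //; apply: le_trans (ler_wpM2l (normr_ge0 c) (ltW (vx i))) _.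
rewrite mulrCA ler_piMr ?divr_ge0 ?(ltW e0) // ler_pdivrMr // mul1r lerDl //.
Qed.

HB.instance Definition _ :=
  GRing.isSubmodClosed.Build R[i] {ffun I -> H} (range_closure g)
    range_closure_submod.

(** This type receives the Hilbert structure of the direct sum. With orbit maps for [g] it becomes
    the closed cyclic subspace of a sum of representations. *)
Record closed_range := ClosedRange {
  closed_range_val : {ffun I -> H} ;
  _ : closed_range_val \in range_closure g
}.

HB.instance Definition _ := [isSub for closed_range_val].
HB.instance Definition _ := [Choice of closed_range by <:].
HB.instance Definition _ := [SubChoice_isSubLmodule of closed_range by <:].

Local Notation K := closed_range.
Implicit Types v w : K.

Definition cr_inner v w : R[i] := \sum_i inner (val v i) (val w i).

Lemma cr_inner_bilinear : bilinear_for
  ( *%R : GRing.Scale.law _ _) (@Num.conj R[i] \; *%R : GRing.Scale.law _ _)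
  cr_inner.
Proof.
split=> [w|v] c x y.
  rewrite /= /cr_inner mulr_sumr -big_split /=; apply: eq_bigr => i _.
  by rewrite !ffunE linearPl.
rewrite /= /cr_inner mulr_sumr -big_split /=; apply: eq_bigr => i _.
by rewrite !ffunE linearPr.
Qed.
HB.instance Definition _ := bilinear_isBilinear.Build R[i] K K R[i]
  ( *%R) (@Num.conj R[i] \; *%R) cr_inner cr_inner_bilinear.

Lemma cr_inner_hermitian v w :
  cr_inner v w = (-1) ^+ false * (@Num.conj R[i]) (cr_inner w v).
Proof.
rewrite expr0 mul1r rmorph_sum; apply: eq_bigr => i _; exact: inner_conj.
Qed.
HB.instance Definition _ := isHermitianSesquilinear.Build R[i] K false
  (@Num.conj R[i]) cr_inner cr_inner_hermitian.

Lemma cr_innerE v : cr_inner v v = \sum_i `|val v i| ^+ 2.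
Proof. by apply: eq_bigr => i _; rewrite sqr_normr_inner. Qed.

Lemma cr_inner_gt0 v : v != 0 -> 0 < cr_inner v v.
Proof.
move=> v0; rewrite lt0r cr_innerE sumr_ge0 ?andbT => [|i _]; last exact: exprn_ge0.
apply: contra v0 => /eqP/psumr_eq0P vi0; apply/eqP/val_inj/ffunP => i.
rewrite /= !ffunE; apply/eqP; rewrite -normr_eq0 -sqrf_eq0 vi0 // => j _.
Qed.
HB.instance Definition _ := isDotProduct.Build R[i] K cr_inner cr_inner_gt0.

Definition cr_norm v : R[i] := sqrtC (cr_inner v v).

Lemma cr_normD v w : cr_norm (v + w) <= cr_norm v + cr_norm w.
Proof. exact: sqrt_dnormD. Qed.

Lemma cr_normZ c v : cr_norm (c *: v) = `|c| * cr_norm v.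
Proof. exact: sqrt_dnormZ. Qed.

Lemma cr_norm_eq0 v : cr_norm v = 0 -> v = 0.
Proof. by move=> /eqP; rewrite sqrt_dnorm_eq0 => /eqP. Qed.

HB.instance Definition _ :=
  Lmodule_isNormed.Build R[i] K cr_normD cr_normZ cr_norm_eq0.

Lemma cr_sqr_normr v : `|v| ^+ 2 = cr_inner v v.
Proof. exact: sqrtCK. Qed.

Lemma cr_norm_coord v i : `|val v i| <= `|v|.
Proof.
rewrite -ler_sqr ?nnegrE // cr_sqr_normr cr_innerE (bigD1 i) //= lerDl.
by apply: sumr_ge0 => j _; exact: exprn_ge0.
Qed.

Lemma cr_norm_sum v : `|v| <= \sum_i `|val v i|.
Proof.
have s0 (P : pred I) : 0 <= \sum_(i | P i) `|val v i| by exact: sumr_ge0.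
rewrite -ler_sqr ?nnegrE // cr_sqr_normr cr_innerE.
elim: (index_enum I) => [|i s IH]; first by rewrite !big_nil expr0n.
rewrite !big_cons sqrrD -addrA lerD2l; apply: le_trans IH _.
by rewrite lerDr mulrn_wge0 // mulr_ge0 // sumr_ge0.
Qed.

(** Reduces estimates in the direct sum to coordinatewise ones. Adding 1 to the cardinal keeps the
    denominator positive for an empty index type and makes the conclusion strict. *)
Lemma cr_norm_lt v (e : R[i]) : 0 < e ->
  (forall i, `|val v i| < e / (#|I|%:R + 1)) -> `|v| < e.
Proof.
move=> e0 ve; apply: le_lt_trans (cr_norm_sum v) _.
apply: le_lt_trans (ler_sum _ (fun i _ => ltW (ve i))) _.
rewrite sumr_const -[ltLHS]mulr_natr mulrAC -mulrA gtr_pMr //.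
by rewrite ltr_pdivrMr ?ltr_wpDl // mul1r ltrDl.
Qed.

(** Coordinates are bounded by the norm, so they form Cauchy filters and converge in [H]. Since [I]
    is finite the convergence is uniform in the index, which places the limit in the closure and
    gives convergence in norm. *)
Lemma cr_cauchy_cvg (F : set_system K) : ProperFilter F -> cauchy F -> cvg F.
Proof.
move=> FF /cauchyP Fc.
have cF i : cvg ((fun v : K => val v i) @ F).
  apply: cauchy_cvg; apply/cauchyP => e e0; have [v Fv] := Fc e e0.
  exists (val v i); rewrite /fmap /=; apply: filterS Fv => w /=.
  rewrite -!ball_normE /=; apply: le_lt_trans.
  by have := cr_norm_coord (v - w) i; rewrite /= !ffunE.
have [l Fl] : exists l : {ffun I -> H},
    forall i, (fun v : K => val v i) @ F --> l i.
  exists [ffun i => lim ((fun v : K => val v i) @ F)] => i.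
  by rewrite ffunE; exact: cF.
have Fnear (e : R[i]) : 0 < e -> F [set v : K | forall i, `|l i - val v i| < e].
  by move=> e0; apply: filter_forall => i; have /cvgrPdist_lt/(_ _ e0) := Fl i.
have lg : l \in range_closure g.
  apply/range_closureP => e e0; have e2 : 0 < e / 2 by rewrite divr_gt0.
  have [v lv] := filter_ex (Fnear _ e2).
  have /range_closureP/(_ _ e2)[x vx] := valP v.
  exists x => i; rewrite -(subrK (val v i) (l i)) -addrA.
  by apply: le_lt_trans (ler_normD _ _) _; rewrite [ltRHS]splitr ltrD.
apply/cvg_ex; exists (ClosedRange lg); apply/cvgrPdist_lt => e e0.
have e1 : 0 < e / (#|I|%:R + 1) by rewrite divr_gt0 // ltr_wpDl.
apply: filterS (Fnear _ e1) => v lv.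
by apply: cr_norm_lt => // i; rewrite /= !ffunE.
Qed.
HB.instance Definition _ := Uniform_isComplete.Build K cr_cauchy_cvg.

Lemma cr_sqr_normr_inner v : `|v| ^+ 2 = (cr_inner : {dot K for _}) v v.
Proof. exact: cr_sqr_normr. Qed.
HB.instance Definition _ := isHilbert.Build R K cr_sqr_normr_inner.

Lemma closed_range_innerE v w : inner v w = \sum_i inner (val v i) (val w i).
Proof. by []. Qed.

Lemma mem_range_closure x : [ffun i => g i x] \in range_closure g.
Proof.
by apply/range_closureP => e e0; exists x => i; rewrite ffunE subrr normr0.
Qed.

Definition to_closed_range x : K := ClosedRange (mem_range_closure x).

Lemma dense_to_closed_range : dense (range to_closed_range).
Proof.
apply: norm_dense => v e e0.
have e1 : 0 < e / (#|I|%:R + 1) by rewrite divr_gt0 // ltr_wpDl.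
have /range_closureP/(_ _ e1)[x vx] := valP v.
exists (to_closed_range x); first by exists x.
by apply: cr_norm_lt => // i; rewrite /= !ffunE.
Qed.

End DirectSum.

Section ClosedRangeMap.
Variables (R : realType) (D : lmodType R[i]) (H : hilbertType R) (I : finType).
Variable g : I -> {linear D -> H}.
Local Notation K := (closed_range g).

Lemma continuous_closed_range_coord i : continuous (fun v : K => val v i).
Proof.
move=> v; have FF := nbhs_filter v; apply/cvgrPdist_lt => e e0.
apply: (@filterS _ _ FF _ _ _ (nbhsx_ballx v e e0)) => w.
rewrite -ball_normE /=; apply: le_lt_trans.
by have := cr_norm_coord (v - w) i; rewrite /= !ffunE.
Qed.

Variable f : I -> H -> H.
Hypothesis f_continuous : forall i, continuous (f i).

Lemma near_closed_range (v : K) (e : R[i]) : 0 < e ->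
  nbhs v [set w : K | forall i, `|f i (val v i) - f i (val w i)| < e].
Proof.
move=> e0; apply: (@filter_forall _ _ _ _ (nbhs_filter v)) => i.
have : (f i \o (fun v : K => val v i)) @ v --> f i (val v i).
  apply: continuous_comp; first exact: continuous_closed_range_coord.
  exact: f_continuous.
by move=> /cvgrPdist_lt/(_ _ e0).
Qed.

Hypothesis f_range : forall x, exists y, forall i, f i (g i x) = g i y.

(** [f_range] says that the coordinatewise map preserves the range of [g]; continuity carries this
    over to the closure. *)
Lemma closed_range_map_subproof (v : K) :
  [ffun i => f i (val v i)] \in range_closure g.
Proof.
apply/range_closureP => e e0.
have /nbhs_ballP[d /= d0 vd] := near_closed_range v e0.
have [_ [x _ <-] vx] := dense_norm (@dense_to_closed_range _ _ _ _ g) v d0.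
have [y xy] := f_range x; exists y => i; rewrite ffunE.
have /= := vd (to_closed_range g x); rewrite -ball_normE => /(_ vx i).
by rewrite /= ffunE xy.
Qed.

Definition closed_range_map (v : K) : K :=
  ClosedRange (closed_range_map_subproof v).

Lemma closed_range_map_continuous : continuous closed_range_map.
Proof.
move=> v; have FF := nbhs_filter v; apply/cvgrPdist_lt => e e0.
have e1 : 0 < e / (#|I|%:R + 1) by rewrite divr_gt0 // ltr_wpDl.
apply: (@filterS _ _ FF _ _ _ (near_closed_range v e1)) => w vw.
by apply: cr_norm_lt => // i; rewrite /= !ffunE.
Qed.

Lemma closed_range_map_linear : (forall i, linear (f i)) -> linear closed_range_map.
Proof.
by move=> fl c v w; apply/val_inj/ffunP => i; rewrite /= !ffunE fl.
Qed.
End ClosedRangeMap.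

(** * GNS representations of averaged functionals *)

Section AverageGNS.
Variables (R : realType) (D : lmodType R[i]) (mul : D -> D -> D) (inv : D -> D).
Variables (psi : D -> R[i]) (H : hilbertType R) (pi : D -> H -> H) (xi : H).
Hypothesis G : is_GNS mul inv psi pi xi.
Variables (I : finType) (theta : I -> D -> D) (one : D) (c : R[i]).
Hypotheses (theta_linear : forall i, linear (theta i))
  (theta_mul : forall i x y, theta i (mul x y) = mul (theta i x) (theta i y))
  (theta_inv : forall i x, theta i (inv x) = inv (theta i x))
  (theta_one : forall i, theta i one = one).
Hypotheses (mul1x : forall x, mul one x = x) (mulx1 : forall x, mul x one = x)
  (inv1 : inv one = one).

(** The scalar [c] weights the copies of [H]: c = 1/2 with four automorphisms turns the sum of inner
    products into a mean. *)
Let orbit i x : H := c *: pi (theta i x) xi.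

Let orbit_linear i : linear (orbit i).
Proof.
move=> a x y; rewrite /orbit theta_linear (gns_lin G) scalerDr !scalerA.
by rewrite mulrC.
Qed.

Let orbitL i : {linear D -> H} := HB.pack_for {linear D -> H} (orbit i)
  (GRing.isLinear.Build R[i] D H *:%R (orbit i) (orbit_linear i)).

Let pi_orbit x y i : pi (theta i x) (orbitL i y) = orbitL i (mul x y).
Proof.
by rewrite /= /orbit (scalable_linear (gns_linear G _)) -(gns_mul G) theta_mul.
Qed.

Let average_rep x : closed_range orbitL -> closed_range orbitL :=
  closed_range_map (fun i => @gns_continuous _ _ _ _ _ _ _ _ G (theta i x))
    (fun y => ex_intro _ (mul x y) (pi_orbit x y)).

(** On coordinate i, [x] acts by [pi (theta i x)]. The weighted sum of the functionals is then the
    vector functional of the orbit vector of [one], and the domination says that a coordinate is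
    bounded by the norm. *)
Lemma average_gns : exists (K : hilbertType R) (pi' : D -> K -> K) (xi' : K),
  is_GNS mul inv (fun x => \sum_i `|c| ^+ 2 * psi (theta i x)) pi' xi' /\
  forall i x, `|c| * `|pi (theta i x) xi| <= `|pi' x xi'|.
Proof.
pose xi' := to_closed_range orbitL one.
have rep x : average_rep x xi' = to_closed_range orbitL x.
  apply/val_inj/ffunP => i; rewrite /= !ffunE.
  by rewrite [LHS](pi_orbit x one i) mulx1.
exists (closed_range orbitL), average_rep, xi'; split; last first.
  move=> i x; rewrite rep -normrZ.
  by have := cr_norm_coord (to_closed_range orbitL x) i; rewrite /= !ffunE.
split.
- by move=> x; apply: closed_range_map_linear => i; exact: gns_linear G _.
- by move=> x; exact: closed_range_map_continuous.
- move=> a x y v; apply/val_inj/ffunP => i; rewrite /= !ffunE.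
  by rewrite theta_linear (gns_lin G).
- move=> x y v; apply/val_inj/ffunP => i; rewrite /= !ffunE.
  by rewrite theta_mul (gns_mul G).
- move=> x v w; rewrite !closed_range_innerE; apply: eq_bigr => i _.
  by rewrite /= !ffunE theta_inv (gns_star G).
- rewrite (_ : [set _ | _ in _] = range (to_closed_range orbitL)).
    exact: dense_to_closed_range.
  by apply: eq_imagel => x _; exact: rep.
- move=> x; rewrite rep closed_range_innerE; apply: eq_bigr => i _.
  rewrite /= !ffunE /= /orbit linearZl_LR linearZr_LR /= mulrA -normCK theta_one.
  (* The cyclic vector has coordinates proportional to [pi one xi] rather than [xi]; moving [pi one]
     across the inner product turns it into a left multiplication by the unit. *)
  by rewrite -inv1 -(gns_star G) -(gns_mul G) mul1x (gns_vector G).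
Qed.
End AverageGNS.

(** * Extension of isometries from dense subspaces *)

Section DenseExtension.
Variable R : realType.

Lemma lipschitz_bound_continuous (U V : normedModType R[i]) (f : U -> V) (M : R[i]) :
  0 <= M -> (forall v w, `|f v - f w| <= M * `|v - w|) -> continuous f.
Proof.
move=> M0 fM v; apply/cvgrPdist_lt => e e0.
have M1 : 0 < M + 1 by rewrite ltr_wpDl.
apply: filterS (nbhsx_ballx v (e / (M + 1)) (divr_gt0 e0 M1)) => w.
rewrite -ball_normE /= ltr_pdivlMr // mulrC; apply: le_lt_trans.
by apply: le_trans (fM v w) _; rewrite ler_wpM2r // lerDl.
Qed.

Lemma eq_continuous_dense (U V : normedModType R[i]) (f g : U -> V) (S : set U) :
  continuous f -> continuous g -> dense S -> {in S, f =1 g} -> f =1 g.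
Proof.
move=> fc gc dS fg v; apply/eqP; rewrite -subr_eq0 -normr_le0.
apply/ler_addgt0Pr => e e0; rewrite add0r.
have e2 : 0 < e / 2 by rewrite divr_gt0.
have /nbhs_ballP[d /= d0 vd] :
    nbhs v [set w | `|f v - f w| < e / 2 /\ `|g v - g w| < e / 2].
  by apply: filterI; [have /cvgrPdist_lt := fc v|have /cvgrPdist_lt := gc v]; exact.
have [s Ss vs] := dense_norm dS v d0.
have [] := vd s; first by rewrite -ball_normE.
rewrite (fg s) ?inE // => fs gs; rewrite -(subrK (g s) (f v)) -addrA.
apply: ltW; apply: le_lt_trans (ler_normD _ _) _; rewrite [ltRHS]splitr.
by rewrite ltrD // distrC.
Qed.

Section Isometry.
Variables (D : lmodType R[i]) (U V : completeNormedModType R[i]).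
Variables (j1 : D -> U) (j2 : D -> V).
Hypotheses (j1_linear : linear j1) (j2_linear : linear j2).
Hypotheses (j_isometry : forall x, `|j1 x| = `|j2 x|) (j1_dense : dense (range j1)).

Let jB (W : lmodType R[i]) (j : D -> W) x y : linear j -> j (x - y) = j x - j y.
Proof. by move=> /zmod_morphism_linear. Qed.

Lemma isometry_limit (f : U) : exists y : V, forall e : R[i], 0 < e ->
  exists2 x, `|f - j1 x| < e & `|y - j2 x| < e.
Proof.
(* The filter of [j2]-images of points whose [j1]-images approach [f]. It is proper by density and
   Cauchy by the isometry, so it has a limit. *)
pose G : set_system V := [set P | exists2 e : R[i], 0 < e &
  forall x, `|f - j1 x| < e -> P (j2 x)].
have near1 (e : R[i]) : 0 < e -> exists x, `|f - j1 x| < e.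
  by move=> e0; have [_ [x _ <-] fx] := dense_norm j1_dense f e0; exists x.
have GF : ProperFilter G.
  split=> [[e e0 eP]|]; first by have [x fx] := near1 _ e0; exact: eP fx.
  split; first by exists 1.
  - move=> P Q [a a0 aP] [b b0 bQ]; have [c [c0 ca cb]] := exists_gt0_min a0 b0.
    by exists c => // x fx; split; [apply: aP|apply: bQ]; exact: lt_le_trans fx _.
  - by move=> P Q PQ [a a0 aP]; exists a => // x fx; exact/PQ/aP.
have : cvg G.
  apply: cauchy_cvg; apply/cauchyP => e e0.
  have e2 : 0 < e / 2 by rewrite divr_gt0.
  have [x fx] := near1 _ e2; exists (j2 x); exists (e / 2) => // y fy.
  rewrite -ball_normE /= -jB // -j_isometry jB // -(subrK f (j1 x)) -addrA.
  apply: le_lt_trans (ler_normD _ _) _; rewrite [ltRHS]splitr ltrD //.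
  by rewrite distrC.
move=> /cvg_ex[y Gy]; exists y => e e0.
have [d d0 yd] := Gy _ (nbhsx_ballx y e e0).
have [c [c0 cd ce]] := exists_gt0_min d0 e0.
have [x fx] := near1 _ c0; exists x; first exact: lt_le_trans ce.
by have := yd x (lt_le_trans fx cd); rewrite -ball_normE.
Qed.

(** The limits are picked by choice. Each property then follows by approximating the arguments and
    their values simultaneously, and comparing errors of order e. *)
Lemma isometry_extension : exists k : U -> V,
  [/\ linear k, forall f, `|k f| = `|f| & forall x, k (j1 x) = j2 x].
Proof.
have [k kP] := choice isometry_limit; exists k.
have small (W : normedModType R[i]) (w : W) (M : R[i]) : 0 <= M ->
    (forall e : R[i], 0 < e -> `|w| <= M * e) -> w = 0.
  move=> M0 wM; apply/eqP; rewrite -normr_le0; apply/ler_addgt0Pr => e e0.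
  have M1 : 0 < M + 1 by rewrite ltr_wpDl.
  rewrite add0r; apply: le_trans (wM _ (divr_gt0 e0 M1)) _.
  by rewrite mulrCA ler_piMr ?(ltW e0) // ler_pdivrMr // mul1r lerDl.
have kj x : k (j1 x) = j2 x.
  apply/eqP; rewrite -subr_eq0; apply/eqP/(small _ _ 2) => // e e0.
  have [y xy ky] := kP (j1 x) e e0; rewrite -(subrK (j2 y) (k _)) -addrA.
  apply: le_trans (ler_normD _ _) _; rewrite mulr_natl lerD ?(ltW ky) //.
  by rewrite -jB // -j_isometry jB // distrC ltW.
have kD c f g : k (c *: f + g) = c *: k f + k g.
  apply/eqP; rewrite -subr_eq0; apply/eqP.
  (* The defect of linearity is at most the sum of two errors, one in [V] and one in [U], each at
     most (|c| + 2) e. *)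
  apply: (small _ _ (2 * (`|c| + 2))) => [|e e0]; first by rewrite mulr_ge0 ?addr_ge0.
  have [x fx kx] := kP f e e0; have [y fy ky] := kP g e e0.
  have [z fz kz] := kP (c *: f + g) e e0.
  have bound (W : normedModType R[i]) (w1 w2 w3 v1 v2 v3 : W) :
      `|w1 - v1| < e -> `|w2 - v2| < e -> `|w3 - v3| < e ->
      `|w3 - (c *: w1 + w2) - (v3 - (c *: v1 + v2))| <= (`|c| + 2) * e.
    move=> w1v w2v w3v; set s := c *: w1 + w2; set t := c *: v1 + v2.
    have -> : w3 - s - (v3 - t) = (w3 - v3) - (c *: (w1 - v1) + (w2 - v2)).
      have -> : c *: (w1 - v1) + (w2 - v2) = s - t.
        by rewrite scalerBr addrACA -opprD.
      by rewrite (opprD v3) (opprD s) !opprK addrACA.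
    apply: le_trans (ler_normB _ _) _.
    apply: le_trans (lerD (ltW w3v) (ler_normD _ _)) _.
    rewrite normrZ addrCA mulrDl mulr_natl lerD ?ler_wpM2l ?(ltW w1v) //.
    by rewrite lerD // ltW.
  have bk := bound V _ _ _ _ _ _ kx ky kz.
  have bj := bound U _ _ _ _ _ _ fx fy fz.
  rewrite -(subrK (j2 z - (c *: j2 x + j2 y)) (_ - _)).
  apply: le_trans (ler_normD _ _) _; rewrite -mulrA mulr_natl lerD //.
  rewrite -j2_linear -jB // -j_isometry jB // j1_linear.
  by move: bj; rewrite subrr sub0r normrN.
split=> // f; apply/eqP; rewrite -subr_eq0 -(normr_id (k f)) -(normr_id f); apply/eqP.
apply: (small _ _ 2) => // e e0; have [x fx kx] := kP f e e0.
rewrite !normr_id -(subrK `|j2 x| `|k f|) -addrA.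
apply: le_trans (ler_normD _ _) _; rewrite mulr_natl lerD //.
  by apply: le_trans (ler_dist_dist _ _) _; exact: ltW.
rewrite -j_isometry distrC; apply: le_trans (ler_dist_dist _ _) _; exact: ltW.
Qed.
End Isometry.
End DenseExtension.

(** * Uniqueness of C*-completions *)

Section CompletionUnique.
Variable R : realType.

(** The C*-identity and submultiplicativity bound the square of |y| by |star y| |y|; applying this
    to both x and its adjoint gives equality. *)
Lemma normr_star (A : cstarAlgType R) (x : A) : `|star x| = `|x|.
Proof.
have le (y : A) : `|y| <= `|star y|.
  have [->|y0] := eqVneq y 0; first by rewrite normr0.
  have ny : 0 < `|y| by rewrite normr_gt0.
  rewrite -(ler_pM2r ny) -expr2 -normr_star_cmul; exact: normr_cmul_le.
by apply/eqP; rewrite eq_le -{2}(starK x) !le.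
Qed.

Lemma starB (A : cstarAlgType R) : {morph @star R A : x y / x - y}.
Proof.
by move=> x y; rewrite starD -scaleN1r (starZ (-1)) rmorphN1 scaleN1r.
Qed.

Lemma star_continuous (A : cstarAlgType R) : continuous (@star R A).
Proof.
apply: (@lipschitz_bound_continuous _ A A _ 1) => // x y.
by rewrite -starB normr_star mul1r.
Qed.

Lemma mull_continuous (A : cstarAlgType R) (a : A) : continuous ( *%R a : A -> A).
Proof.
apply: (@lipschitz_bound_continuous _ A A _ `|a|) => // x y.
by rewrite -mulrBr; exact: normr_cmul_le.
Qed.

Lemma mulr_continuous (A : cstarAlgType R) (a : A) :
  continuous (fun x : A => x * a).
Proof.
apply: (@lipschitz_bound_continuous _ A A _ `|a|) => // x y.
by rewrite -mulrBl mulrC; exact: normr_cmul_le.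
Qed.

Lemma isometry_continuous (U V : normedModType R[i]) (k : U -> V) :
  linear k -> (forall f, `|k f| = `|f|) -> continuous k.
Proof.
move=> kl kn; apply: (@lipschitz_bound_continuous _ _ _ _ 1) => // v w.
by rewrite mul1r -kn (zmod_morphism_linear kl).
Qed.

Variables (D : lmodType R[i]) (mul : D -> D -> D) (inv : D -> D).
Variable (nrm : D -> \bar R).

(** The two embeddings have equal norms, so each extends along the other. The extensions are
    mutually inverse and respect products and adjoints because these identities hold on the dense
    range. *)
Lemma cstar_completion_unique (F X : cstarAlgType R) (j1 : D -> F) (j2 : D -> X) :
    is_cstar_completion mul inv nrm j1 -> is_cstar_completion mul inv nrm j2 ->
  exists k : F -> X,
    [/\ star_isomorphism k, continuous k & forall x, k (j1 x) = j2 x].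
Proof.
move=> [l1 m1 s1 n1 d1] [l2 m2 s2 n2 d2].
have j12 x : `|j1 x| = `|j2 x|.
  have : (complex.Re `|j1 x|)%:E = (complex.Re `|j2 x|)%:E by rewrite n1 n2.
  by move=> [e]; rewrite -[LHS]ge0_Re // e ge0_Re.
have [k [kl kn kj]] := isometry_extension l1 l2 j12 d1.
have [k' [k'l k'n k'j]] := isometry_extension l2 l1 (fun x => esym (j12 x)) d2.
have kc := isometry_continuous kl kn.
have k'c := isometry_continuous k'l k'n.
have kK : cancel k k'.
  apply: eq_continuous_dense (d1) _ => [x|x|_ /[!inE] -[x _ <-]]; last by rewrite kj k'j.
    by apply: continuous_comp; [exact: kc|exact: k'c].
  exact: cvg_id.
have k'K : cancel k' k.
  apply: eq_continuous_dense (d2) _ => [x|x|_ /[!inE] -[x _ <-]]; last by rewrite k'j kj.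
    by apply: continuous_comp; [exact: k'c|exact: kc].
  exact: cvg_id.
have kM : {morph k : x y / x * y}.
  (* Density is used in one variable at a time, so only the continuity of one-sided multiplications
     is required. *)
  move=> x y; move: x; apply: eq_continuous_dense (d1) _.
  - move=> x; apply: (@continuous_comp _ _ _ (fun x : F => x * y) k).
      exact: mulr_continuous.
    exact: kc.
  - move=> x; apply: (@continuous_comp _ _ _ k (fun z : X => z * k y)).
      exact: kc.
    exact: mulr_continuous.
  move=> _ /[!inE] -[x _ <-]; move: y; apply: eq_continuous_dense (d1) _.
  - move=> y; apply: (@continuous_comp _ _ _ ( *%R (j1 x)) k).
      exact: mull_continuous.
    exact: kc.
  - move=> y; apply: (@continuous_comp _ _ _ k ( *%R (k (j1 x)))).
      exact: kc.
    exact: mull_continuous.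
  by move=> _ /[!inE] -[y _ <-]; rewrite -m1 !kj m2.
have kS : {morph k : x / star x}.
  apply: eq_continuous_dense (d1) _.
  - move=> x; apply: (@continuous_comp _ _ _ (@star R F) k).
      exact: star_continuous.
    exact: kc.
  - move=> x; apply: (@continuous_comp _ _ _ k (@star R X)).
      exact: kc.
    exact: star_continuous.
  by move=> _ /[!inE] -[x _ <-]; rewrite -s1 !kj s2.
exists k; split=> //; split; last by exists k'.
(* Surjectivity gives the unit: k 1 = k 1 * k (k' 1) = k (k' 1) = 1. *)
by split=> //; rewrite -[LHS]mulr1 -{1}(k'K 1) -kM mul1r k'K.
Qed.
End CompletionUnique.

(** * Parity components *)

Section HomogeneousParts.
Variables (R : realType) (E : cstarAlgType R) (gam : E -> E).
Hypothesis gamG : z2_grading gam.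

Let gam_lin : linear gam. Proof. by case: gamG => -[[]]. Qed.
Let gamK : involutive gam. Proof. by case: gamG. Qed.

Lemma hpart_sum a : hpart gam false a + hpart gam true a = a.
Proof.
rewrite /hpart expr0 expr1 scale1r scaleN1r -scalerDr addrACA subrr addr0.
by rewrite -[a in LHS]scale1r -scalerDl scalerA mulVf ?scale1r // pnatr_eq0.
Qed.

Lemma homogeneous_hpart s a : homogeneous gam s (hpart gam s a).
Proof.
rewrite /homogeneous /hpart /= (scalable_linear gam_lin) /= (linear_morphD gam_lin).
rewrite (scalable_linear gam_lin) /= gamK [in RHS]scalerA mulrC -scalerA.
congr (_ *: _); rewrite scalerDr scalerA -expr2 sqrr_sign scale1r addrC //.
Qed.

Lemma homogeneousM s t a b : homogeneous gam s a -> homogeneous gam t b ->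
  homogeneous gam (s (+) t) (a * b).
Proof.
rewrite /homogeneous /= => ea eb; case: gamG => -[[_ gM _ _] _] _.
by rewrite gM ea eb -(scalerAl _ a) -(scalerAr _ a) scalerA signr_addb.
Qed.

Lemma homogeneous_star s a : homogeneous gam s a -> homogeneous gam s (star a).
Proof.
rewrite /homogeneous /= => ea; case: gamG => -[[_ _ _ gS] _] _.
by rewrite gS ea (starZ _ a) rmorph_sign.
Qed.
End HomogeneousParts.

(** Every elementary tensor is the sum of four products of parity components. Identities can thus be
    checked where the Fermi signs are explicit. *)
Lemma tensor_ext_homogeneous (R : realType) (A B : cstarAlgType R)
    (alpha : A -> A) (beta : B -> B) (W : zmodType) (f g : tensor A B -> W) :
    z2_grading alpha -> z2_grading beta ->
    {morph f : x y / x + y} -> {morph g : x y / x + y} ->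
    (forall s t a b, homogeneous alpha s a -> homogeneous beta t b ->
      f (tens a b) = g (tens a b)) ->
  f =1 g.
Proof.
move=> aG bG fD gD fg; apply: tensor_ext => // a b.
rewrite -(hpart_sum alpha a) -(hpart_sum beta b) !(tensDl, tensDr) !(fD, gD).
by do ![congr (_ + _)]; apply: fg; exact: homogeneous_hpart.
Qed.

(** * The ungraded tensor product *-algebra and its product maps *)

Section MinimalProduct.
Variables (R : realType) (A B : cstarAlgType R).
Local Notation T := (tensor A B).

Lemma star1 : star (1 : A) = 1.
Proof.
by have := star_cmul (star (cone : A)) cone; rewrite cmulx1 starK cmulx1 => <-.
Qed.

Lemma tensor_mul_linearl (y : T) : linear (fun x => tensor_mul x y).
Proof.
apply: (proj1 (tlift_linear _ _)) => [b|a]; apply: tlift_linear_fun => a' b' c x z.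
  by rewrite mulrDl tensDl -(scalerAl c) tensZl.
by rewrite mulrDl tensDr -(scalerAl c) tensZr.
Qed.

Lemma tensor_mul_linearr (x : T) : linear (tensor_mul x).
Proof.
apply: tlift_linear_fun => a b; apply: (proj1 (tlift_linear _ _)) => [b'|a'] c y z.
  by rewrite mulrDr tensDl -(scalerAr c) tensZl.
by rewrite mulrDr tensDr -(scalerAr c) tensZr.
Qed.

Lemma tensor_mulDl (x y z : T) :
  tensor_mul (x + y) z = tensor_mul x z + tensor_mul y z.
Proof. exact: (linear_morphD (tensor_mul_linearl z) x y). Qed.

Lemma tensor_mulDr (x y z : T) :
  tensor_mul x (y + z) = tensor_mul x y + tensor_mul x z.
Proof. exact: (linear_morphD (tensor_mul_linearr x) y z). Qed.

Lemma tensor_starD : {morph @tensor_star R A B : x y / x + y}.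
Proof.
apply: tliftD => [a1 a2 b1|a1 b1 b2|c a1 b1].
- by rewrite starD tensDl.
- by rewrite starD tensDr.
- by rewrite !starZ tensZl tensZr.
Qed.

Lemma tensor_mul1x (x : T) : tensor_mul (tens 1 1) x = x.
Proof.
move: x; apply: tensor_ext => [||a b] //; last by rewrite tensor_mulE !mul1r.
by move=> x y; rewrite tensor_mulDr.
Qed.

Lemma tensor_mulx1 (x : T) : tensor_mul x (tens 1 1) = x.
Proof.
move: x; apply: tensor_ext => [||a b] //; last by rewrite tensor_mulE !mulr1.
by move=> x y; rewrite tensor_mulDl.
Qed.

Definition tensor_map (f : A -> A) (g : B -> B) (x : T) : T :=
  tlift (fun a b => tens (f a) (g b)) x.

Variables (f : A -> A) (g : B -> B).
Hypotheses (f_morph : star_morphism f) (g_morph : star_morphism g).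

Let f_lin : linear f. Proof. by case: f_morph. Qed.
Let g_lin : linear g. Proof. by case: g_morph. Qed.

Let tensor_mapP : linear (tensor_map f g) /\
  forall a b, tensor_map f g (tens a b) = tens (f a) (g b).
Proof.
apply: tlift_linear => [b|a] c x y; first by rewrite f_lin tensDl tensZl.
by rewrite g_lin tensDr tensZr.
Qed.

Lemma tensor_map_linear : linear (tensor_map f g).
Proof. by case: tensor_mapP. Qed.

Lemma tensor_mapE a b : tensor_map f g (tens a b) = tens (f a) (g b).
Proof. by case: tensor_mapP. Qed.

Lemma tensor_map_mul x y : tensor_map f g (tensor_mul x y) =
  tensor_mul (tensor_map f g x) (tensor_map f g y).
Proof.
have mD := linear_morphD tensor_map_linear.
move: x; apply: tensor_ext => [x z|x z|a b].
- by rewrite tensor_mulDl mD.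
- by rewrite mD tensor_mulDl.
move: y; apply: tensor_ext => [x z|x z|a' b'].
- by rewrite tensor_mulDr mD.
- by rewrite mD tensor_mulDr.
rewrite !tensor_mulE !tensor_mapE tensor_mulE.
by case: f_morph => _ -> _ _; case: g_morph => _ -> _ _.
Qed.

Lemma tensor_map_star x :
  tensor_map f g (tensor_star x) = tensor_star (tensor_map f g x).
Proof.
have mD := linear_morphD tensor_map_linear.
move: x; apply: tensor_ext => [x z|x z|a b].
- by rewrite tensor_starD mD.
- by rewrite mD tensor_starD.
rewrite !tensor_starE !tensor_mapE tensor_starE.
by case: f_morph => _ _ _ ->; case: g_morph => _ _ _ ->.
Qed.

Lemma tensor_map1 : tensor_map f g (tens 1 1) = tens 1 1.
Proof.
by rewrite tensor_mapE; case: f_morph => _ _ -> _; case: g_morph => _ _ -> _.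
Qed.
End MinimalProduct.

Lemma product_functional_linear (R : realType) (A B : cstarAlgType R)
    (w : A -> R[i]) (p : B -> R[i]) :
  scalar w -> scalar p -> scalar (product_functional w p).
Proof.
move=> wl pl; pose f (x : A) (y : B) : R[i]^o := w x * p y.
apply: (proj1 (@tlift_linear _ A B R[i]^o f _ _)) => [z|z] c x y.
  by rewrite /f wl mulrDl -mulrA.
by rewrite /f pl mulrDr mulrCA.
Qed.

(** * The Klein map on the algebraic tensor product *)

Section Klein.
Variables (R : realType) (A B : cstarAlgType R).
Variables (alpha : A -> A) (beta : B -> B) (u : A).
Hypotheses (alphaG : z2_grading alpha) (betaG : z2_grading beta).
Hypotheses (u_sau : selfadjoint_unitary u) (alpha_ad : forall a, alpha a = ad u a).
Local Notation T := (tensor A B).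

Definition klein (x : T) : T :=
  tlift (fun a b => tens a (hpart beta false b) + tens (a * u) (hpart beta true b)) x.

Let uu : u * u = 1. Proof. by case: u_sau => us uu _; rewrite -{1}us. Qed.
Let us : star u = u. Proof. by case: u_sau. Qed.
Let beta_lin : linear beta. Proof. by case: betaG => -[[]]. Qed.

Let kleinP : linear klein /\ forall a b,
  klein (tens a b) = tens a (hpart beta false b) + tens (a * u) (hpart beta true b).
Proof.
apply: tlift_linear => [b|a] c x y.
  by rewrite mulrDl -(scalerAl c) !(tensDl, tensZl) scalerDr addrACA.
by rewrite !(hpart_linear _ beta_lin) !tensDr !(tensZr c) scalerDr addrACA.
Qed.

Lemma klein_linear : linear klein. Proof. by case: kleinP. Qed.

Lemma klein_tens a b :
  klein (tens a b) = tens a (hpart beta false b) + tens (a * u) (hpart beta true b).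
Proof. by case: kleinP. Qed.

Let kleinD : {morph klein : x y / x + y}.
Proof. exact: linear_morphD klein_linear. Qed.

Lemma klein_homogeneous t a b : homogeneous beta t b ->
  klein (tens a b) = tens (a * u ^+ t) b.
Proof.
move=> bt; rewrite klein_tens !(hpart_homogeneous _ bt).
by case: t {bt} => /=; rewrite ?tens0r ?add0r ?addr0 ?expr0 ?expr1 ?mulr1.
Qed.

(** The second factor keeps its parity and u squares to 1. One map therefore serves in both
    directions, and the defining equation of the Klein transformation says that [kappa] sends
    [jF (klein x)] to [jX x]. *)
Lemma kleinK : involutive klein.
Proof.
move=> x; move: x.
apply: (tensor_ext_homogeneous (f := klein \o klein) (g := idfun) alphaG betaG).
- by move=> x y; rewrite /= !kleinD.
- by [].
move=> s t a b _ bt /=.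
rewrite !(klein_homogeneous _ bt) -mulrA -expr2 -exprM mulnC exprM.
by rewrite (expr2 u) uu expr1n mulr1.
Qed.

(** As u implements the grading, it commutes with even elements and anticommutes with odd ones. All
    Fermi signs are recovered from this rule. *)
Let u_homogeneous (s t : bool) a : homogeneous alpha s a ->
  u ^+ t * a = (-1) ^+ (t && s) *: (a * u ^+ t).
Proof.
rewrite /homogeneous /= alpha_ad /ad us => as_.
case: t => /=; last by rewrite !expr0 mul1r mulr1 scale1r.
rewrite expr1 -[u * a]mulr1 -uu mulrA as_.
by rewrite (scalerAl _ a).
Qed.

(** In the ungraded product u^t has to move past a'; the sign that this costs is the sign of the
    Fermi product. *)
Lemma klein_mul x y :
  klein (fermi_mul alpha beta x y) = tensor_mul (klein x) (klein y).
Proof.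
move: x; apply: (tensor_ext_homogeneous alphaG betaG) => [x z|x z|s t a b _ bt].
- by rewrite (linear_morphD (fermi_mul_linearl alpha betaG _)) kleinD.
- by rewrite (kleinD x z) tensor_mulDl.
move: y; apply: (tensor_ext_homogeneous alphaG betaG) => [y z|y z|s' t' a' b' as' bt'].
- by rewrite (linear_morphD (fermi_mul_linearr beta alphaG _)) kleinD.
- by rewrite (kleinD y z) tensor_mulDr.
rewrite (fermi_mulE alphaG betaG _ _ bt as') (klein_homogeneous _ bt).
rewrite (klein_homogeneous _ bt') tensor_mulE.
rewrite -tensZl (klein_homogeneous _ (homogeneousM betaG bt bt')).
congr tens; rewrite -mulrA [u ^+ t * _]mulrA (u_homogeneous _ as').
rewrite -(scalerAl _ (a * a')) -(scalerAl _ (a' * _)) -(scalerAr _ a); congr (_ *: _).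
rewrite !mulrA -!mulrA; do 2!congr (_ * _); rewrite -exprD.
(* Exponents add as natural numbers and parities modulo 2; they differ only for two odd factors,
   where u^2 = 1. *)
by case: (t) (t') => -[] //=; rewrite expr2 uu expr0.
Qed.

(** Here the sign comes from reordering u^t and [star a] in the adjoint of a u^t. *)
Lemma klein_star x : klein (fermi_star alpha beta x) = tensor_star (klein x).
Proof.
move: x; apply: (tensor_ext_homogeneous alphaG betaG) => [x z|x z|s t a b as_ bt].
- by rewrite (fermi_starD alphaG betaG) kleinD.
- by rewrite kleinD tensor_starD.
rewrite (fermi_starE alphaG betaG as_ bt) (klein_homogeneous _ bt) tensor_starE.
rewrite -tensZl (klein_homogeneous _ (homogeneous_star betaG bt)); congr tens.
have -> : star (a * u ^+ t) = u ^+ t * star a.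
  rewrite [LHS]star_cmul; congr (_ * _).
  by case: (t); rewrite ?expr0 ?expr1 ?star1.
rewrite (u_homogeneous _ (homogeneous_star alphaG as_)) andbC.
by rewrite (scalerAl _ (star a)).
Qed.

(** On even b the map [klein] fixes the tensor; on odd b both sides vanish because p b = - p b. *)
Lemma product_functional_klein (w : A -> R[i]) (p : B -> R[i]) :
    scalar w -> scalar p -> p \o beta = p ->
  product_functional w p \o klein = product_functional w p.
Proof.
move=> wl pl pb; apply/funext.
have fl := product_functional_linear wl pl.
have fD : {morph product_functional w p : x y / x + y}.
  by move=> x y; rewrite -{1}[x]scale1r fl mul1r.
apply: (tensor_ext_homogeneous alphaG betaG) => [x y|x y|s t a b _ bt] //=.
  by rewrite kleinD fD.
rewrite (klein_homogeneous _ bt) !product_functionalE //.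
case: t bt => /=; last by rewrite mulr1.
rewrite /homogeneous /= expr1 => bt.
have : p b = - p b.
  rewrite -{1}pb /= bt -[RHS]mulN1r.
  exact: (scalable_linear (pl : linear (p : B -> R[i]^o)) (-1) b).
by move=> /eqP; rewrite -addr_eq0 -mulr2n mulrn_eq0 /= => /eqP ->; rewrite !mulr0.
Qed.
End Klein.

(** * Averages of states under the gradings *)

Section EvenAverage.
Variables (R : realType).

Definition even_average (A : cstarAlgType R) (alpha : A -> A) (w : A -> R[i])
  (a : A) : R[i] := 2^-1 * (w a + w (alpha a)).

Lemma even_average_state (A : cstarAlgType R) (alpha : A -> A) (w : A -> R[i]) :
  z2_grading alpha -> @state R A w -> even_state alpha (even_average alpha w).
Proof.
move=> [[[al aM a1 aS] _] aK] [wl wp w1]; split; first split.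
- by move=> c x y; rewrite /even_average al !wl; ring.
- move=> a; rewrite mulr_ge0 ?invr_ge0 // addr_ge0 ?wp //.
  by rewrite aM aS wp.
- by rewrite /even_average a1 w1 -[1 + 1]/(2%:R) mulVf // pnatr_eq0.
by apply/funext => a; rewrite /even_average /= aK addrC.
Qed.

Variables (A B : cstarAlgType R) (alpha : A -> A) (beta : B -> B).
Hypotheses (alphaG : z2_grading alpha) (betaG : z2_grading beta).

Definition twist (i : bool * bool) : tensor A B -> tensor A B :=
  tensor_map (if i.1 then alpha else idfun) (if i.2 then beta else idfun).

Lemma star_morphism_id (E : cstarAlgType R) : star_morphism (@idfun E).
Proof. by split. Qed.

Lemma twist_id : twist (false, false) =1 id.
Proof.
apply: tensor_ext => // [x y|a b]; last first.
  by apply: tensor_mapE; exact: star_morphism_id.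
by apply: linear_morphD; apply: tensor_map_linear; exact: star_morphism_id.
Qed.

Lemma twist_morphism (E : cstarAlgType R) (gam : E -> E) (s : bool) :
  z2_grading gam -> star_morphism (if s then gam else idfun).
Proof. by move=> [[gM _] _]; case: s => //; exact: star_morphism_id. Qed.

(** Expanding the product of the two means gives four terms of weight 1/4, one for each twist. The
    weight is written as a squared modulus to match [average_gns] with c = 1/2. *)
Lemma product_functional_even_average (w : A -> R[i]) (p : B -> R[i]) :
    @state R A w -> @state R B p ->
  product_functional (even_average alpha w) (even_average beta p) =
  (fun x => \sum_i `|2^-1 : R[i]| ^+ 2 * product_functional w p (twist i x)).
Proof.
move=> ws ps.
have [[wl' _ _] _] := even_average_state alphaG ws.
have [[pl' _ _] _] := even_average_state betaG ps.
case: ws ps => wl _ _ [pl _ _].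
have lD (f : tensor A B -> R[i]) : scalar f -> {morph f : x y / x + y}.
  by move=> fl x y; rewrite -{1}[x]scale1r fl mul1r.
have fD := lD _ (product_functional_linear wl pl).
have twD i : {morph twist i : x y / x + y}.
  by apply/linear_morphD/tensor_map_linear; exact: twist_morphism.
have twE i a b : twist i (tens a b) =
    tens (if i.1 then alpha a else a) (if i.2 then beta b else b).
  by rewrite [LHS]tensor_mapE; try exact: twist_morphism; case: i => -[] [].
apply/funext; apply: tensor_ext => [|x y|a b].
- exact/lD/product_functional_linear.
- rewrite -big_split; apply: eq_bigr => i _.
  by rewrite twD fD mulrDr.
rewrite product_functionalE // ger0_norm ?invr_ge0 // -mulr_sumr.
rewrite -(pair_big xpredT xpredT (fun s t =>
  product_functional w p (twist (s, t) (tens a b)))) /=.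
rewrite !big_bool /= !twE !product_functionalE // /even_average /=; ring.
Qed.
End EvenAverage.

(** * Transport of GNS norms along an involutive isomorphism *)

Section GNSTransport.
Variables (R : realType) (D : lmodType R[i]).
Variables (mul mul' : D -> D -> D) (inv inv' : D -> D) (h : D -> D).
Hypotheses (h_linear : linear h) (hK : involutive h).
Hypotheses (h_mul : forall x y, h (mul' x y) = mul (h x) (h y))
  (h_inv : forall x, h (inv' x) = inv (h x)).

Lemma is_GNS_comp (psi : D -> R[i]) (H : hilbertType R) (pi : D -> H -> H) (xi : H) :
  is_GNS mul inv psi pi xi -> is_GNS mul' inv' (psi \o h) (pi \o h) xi.
Proof.
case=> pl pc plin pm ps pd pv; split=> /=.
- by move=> x; exact: pl.
- by move=> x; exact: pc.
- by move=> c x y v; rewrite h_linear plin.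
- by move=> x y v; rewrite h_mul pm.
- by move=> x v w; rewrite h_inv ps.
- rewrite (_ : [set _ | _ in _] = [set pi x xi | x in setT]) //.
  by apply/seteqP; split=> _ [x _ <-]; exists (h x); rewrite /= ?hK.
- by move=> x; rewrite pv.
Qed.
End GNSTransport.

Lemma gns_sup_comp (R : realType) (D : lmodType R[i])
    (mul mul' : D -> D -> D) (inv inv' : D -> D) (h : D -> D)
    (S : set (D -> R[i])) :
    linear h -> involutive h ->
    (forall x y, h (mul' x y) = mul (h x) (h y)) ->
    (forall x, h (inv' x) = inv (h x)) ->
    (forall psi, S psi -> psi \o h = psi) ->
  forall x, gns_sup mul' inv' S x = gns_sup mul inv S (h x).
Proof.
move=> hl hK hm hi hS x; congr (ereal_sup _); apply/seteqP.
(* Being an involution, [h] is a homomorphism in the reverse direction as well, so GNS triples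
   travel both ways with the same operators. *)
have hm' y z : h (mul y z) = mul' (h y) (h z) by rewrite -[RHS]hK hm !hK.
have hi' y : h (inv y) = inv' (h y) by rewrite -[RHS]hK hi !hK.
split=> _ [psi [H [pi [xi [Spsi G ->]]]]]; exists psi, H, (pi \o h), xi.
  split=> //=; last by rewrite hK.
  by rewrite -(hS _ Spsi); exact: is_GNS_comp.
by split=> //; rewrite -(hS _ Spsi); exact: is_GNS_comp.
Qed.

(** * Equality of the Fermi and minimal norms *)

Section KleinNorm.
Variables (R : realType) (A B : cstarAlgType R).
Variables (alpha : A -> A) (beta : B -> B) (u : A).
Hypotheses (alphaG : z2_grading alpha) (betaG : z2_grading beta).
Hypotheses (u_sau : selfadjoint_unitary u) (alpha_ad : forall a, alpha a = ad u a).
Variables (F : cstarAlgType R) (jF : tensor A B -> F).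
Hypothesis F_fermi : is_fermi_tensor alpha beta jF.
Local Notation klein := (klein beta u).

Lemma fermi_norm_gns_sup x : fermi_norm alpha beta x =
  gns_sup (@tensor_mul R A B) (@tensor_star R A B)
    [set product_functional w p | w in even_state alpha & p in even_state beta]
    (klein x).
Proof.
apply: gns_sup_comp.
- exact: klein_linear.
- exact: kleinK alphaG betaG u_sau.
- exact: klein_mul.
- exact: klein_star.
move=> _ [w [[wl _ _] _] [p [[pl _ _] pb] <-]].
exact: (product_functional_klein u alphaG betaG).
Qed.

Lemma fermi_norm_klein x : fermi_norm alpha beta x = min_norm (klein x).
Proof.
have kK := kleinK alphaG betaG u_sau.
apply/eqP; rewrite eq_le; apply/andP; split.
  rewrite fermi_norm_gns_sup; apply: ereal_sup_le.
  move=> r [psi [H [pi [xi [[w [ws _] [p [ps _] pE]] G ->]]]]].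
  by exists psi, H, pi, xi; split=> //; exists w => //; exists p.
apply: ge_ereal_sup => r [psi [H [pi [xi [[w ws [p ps pE]] G ->]]]]].
(* The supremum over even product states, read as a norm in the C*-algebra [F]: this makes it finite
   and supplies the C*-identity that [gns_dominated] asks for. *)
pose N y := `|jF (klein y)|.
have NE y : gns_sup (@tensor_mul R A B) (@tensor_star R A B)
    [set product_functional w p | w in even_state alpha & p in even_state beta] y =
    (complex.Re (N y))%:E.
  by rewrite /N (completion_norm F_fermi) fermi_norm_gns_sup kK.
rewrite fermi_norm_gns_sup NE.
have twM i : star_morphism (if i then alpha else idfun) by exact: twist_morphism.
have twM' i : star_morphism (if i then beta else idfun) by exact: twist_morphism.
have [K [pi' [xi' [G' dom]]]] := average_gns (theta := twist alpha beta) G 2^-1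
  (fun i : bool * bool => tensor_map_linear (twM i.1) (twM' i.2))
  (fun i : bool * bool => tensor_map_mul (twM i.1) (twM' i.2))
  (fun i : bool * bool => tensor_map_star (twM i.1) (twM' i.2))
  (fun i : bool * bool => tensor_map1 (twM i.1) (twM' i.2))
  (@tensor_mul1x R A B) (@tensor_mulx1 R A B)
  (etrans (tensor_starE _ _) (f_equal2 (@tens _ A B) (star1 A) (star1 B))).
apply: opnorm_le; first exact: normr_ge0.
(* The constant 2 is the inverse of the weight 1/2: the coordinate of the trivial twist is half the
   orbit vector of [pi]. *)
apply: (gns_dominated G G' (c := 2)) => // [y|y|y|y v].
- exact: normr_ge0.
- rewrite /N; transitivity `|star (jF (klein y)) * jF (klein y)|.
    rewrite -(completion_star F_fermi) -(completion_mul F_fermi).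
    congr `|jF _|; apply: (inv_inj kK).
    rewrite kK (klein_mul alphaG betaG u_sau) //.
    by rewrite (klein_star alphaG betaG u_sau) // !kK.
  exact: normr_star_cmul.
- have := dom (false, false) y; rewrite /= normfV ler_pdivrMl ?normr_gt0 ?pnatr_eq0 //.
  by rewrite normr_nat twist_id.
(* [pi'] is a GNS representation of an even product state, so its norm is among those whose supremum
   is [N]. *)
- apply: (@le_opnorm _ K (pi' y) (N y)); [exact: gns_linear G' y|exact: normr_ge0|].
  rewrite -NE; apply: ereal_sup_ubound.
  exists (product_functional (even_average alpha w) (even_average beta p)).
  exists K, pi', xi'.
  split=> //; last by rewrite product_functional_even_average // pE.
  by exists (even_average alpha w); [|exists (even_average beta p)] => //;
    exact: even_average_state.
Qed.

End KleinNorm.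

(** * Transport of even product states *)

Section EvenProductStates.
Variables (R : realType) (A B F X : cstarAlgType R).

Lemma star_morphism_can (k : F -> X) (k' : X -> F) :
  star_morphism k -> cancel k k' -> cancel k' k -> star_morphism k'.
Proof.
move=> [kl kM k1 kS] kK k'K; split.
- by move=> c x y; apply: (can_inj kK); rewrite k'K kl !k'K.
- by move=> x y; apply: (can_inj kK); rewrite kM !k'K.
- by rewrite -k1 kK.
- by move=> x; apply: (can_inj kK); rewrite kS !k'K.
Qed.

Lemma state_comp (k : F -> X) psi : star_morphism k -> @state R X psi ->
  @state R F (psi \o k).
Proof.
move=> [kl kM k1 kS] [pl pp p1]; split=> [c x y|x|] /=; last by rewrite k1.
  by rewrite kl pl.
by rewrite kM kS.
Qed.

(** Stated for a general [k] above [h] so that it applies both to the Klein transformation and to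
    its inverse. On the algebraic tensor product the state is a product functional, which [h] leaves
    invariant, so the same pair of even states works. *)
Lemma even_product_state_comp (alpha : A -> A) (beta : B -> B)
    (jF : tensor A B -> F) (jX : tensor A B -> X) (k : F -> X)
    (h : tensor A B -> tensor A B) (psi : X -> R[i]) :
    star_morphism k -> linear jX -> (forall x, k (jF x) = jX (h x)) ->
    (forall w p, even_state alpha w -> even_state beta p ->
      product_functional w p \o h = product_functional w p) ->
  even_product_state alpha beta jX psi ->
  even_product_state alpha beta jF (psi \o k).
Proof.
move=> kM jl kj hE [ps [w [p [ws pps psiE]]]]; split; first exact: state_comp kM ps.
exists w, p; split=> // a b; rewrite /= kj.
have [[wl _ _] _] := ws; have [[pl _ _] _] := pps.
have psiT : psi \o jX =1 product_functional w p.
  have fl := product_functional_linear wl pl; have [psl _ _] := ps.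
  apply: tensor_ext => [x y|x y|c d] /=; last by rewrite psiE product_functionalE.
    by rewrite (linear_morphD jl) -{1}[jX x]scale1r psl mul1r.
  by rewrite -{1}[x]scale1r fl mul1r.
have := psiT (h (tens a b)); rewrite /= => ->.
have := congr1 (@^~ (tens a b)) (hE w p ws pps) => /= ->.
exact: product_functionalE.
Qed.
End EvenProductStates.

(** * The Klein isomorphism and its transpose *)

Theorem theorem3p1 (R : realType) (A B : cstarAlgType R)
    (alpha : A -> A) (beta : B -> B) (u : A)
    (alpha_grading : z2_grading alpha) (beta_grading : z2_grading beta)
    (u_sau : selfadjoint_unitary u) (alpha_ad : forall a, alpha a = ad u a)
    (F X : cstarAlgType R) (jF : tensor A B -> F) (jX : tensor A B -> X)
    (F_fermi : is_fermi_tensor alpha beta jF) (X_min : is_min_tensor jX) :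
  exists kappa : F -> X,
    [/\ is_klein beta u jF jX kappa,
        forall kappa', is_klein beta u jF jX kappa' -> kappa' = kappa,
        star_isomorphism kappa
      & set_bij (even_product_state alpha beta jX)
                (even_product_state alpha beta jF)
                (fun psi => psi \o kappa)].
Proof.
have kK := kleinK alpha_grading beta_grading u_sau.
have kl := klein_linear u beta_grading.
have kD := linear_morphD kl.
have jFD := linear_morphD (completion_linear F_fermi).
have jXl := completion_linear X_min; have jXD := linear_morphD jXl.
(* Through [jX \o klein], the algebra [X] completes the same normed *-algebra as [F], so uniqueness
   of completions yields [kappa]. *)
have X_klein : is_cstar_completion (fermi_mul alpha beta) (fermi_star alpha beta)
    (fermi_norm alpha beta) (jX \o klein beta u).
  split=> [c x y|x y|x|x|].
  - by rewrite /= kl jXl.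
  - by rewrite /= (klein_mul alpha_grading) // (completion_mul X_min).
  - by rewrite /= (klein_star alpha_grading) // (completion_star X_min).
  - rewrite /= (completion_norm X_min).
    by rewrite (fermi_norm_klein alpha_grading beta_grading u_sau alpha_ad F_fermi).
  rewrite (_ : range (jX \o klein beta u) = range jX).
    exact: completion_dense X_min.
  by apply/seteqP; split=> _ [x _ <-]; exists (klein beta u x); rewrite /= ?kK.
have [kappa [kiso kc kj]] := cstar_completion_unique F_fermi X_klein.
have [[kappa_lin kM k1 kS] kbij] := kiso.
exists kappa; split=> //.
- by split=> // a b; rewrite -jFD -klein_tens // kj /= kK.
- move=> k' [k'l k'c k'E]; apply/funext.
  apply: eq_continuous_dense k'c kc (completion_dense F_fermi) _.
  (* Writing x as [klein] of [klein x] gives the argument the shape in which the defining equation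
     of [k'] applies. *)
  move=> _ /[!inE] -[x _ <-]; rewrite kj /= -{1}(kK x); move: (klein beta u x).
  have k'D := linear_morphD k'l.
  apply: tensor_ext => [y z|y z|a b].
  + by rewrite kD jFD k'D.
  + exact: jXD.
  by rewrite klein_tens // jFD k'E.
have [kinv kappaK kinvK] := kbij.
have kM' := star_morphism_can (And4 kappa_lin kM k1 kS) kappaK kinvK.
have kinvj x : kinv (jX x) = jF (klein beta u x).
  by rewrite -{1}(kK x) -[RHS]kappaK kj.
have pfE w p : even_state alpha w -> even_state beta p ->
    product_functional w p \o klein beta u = product_functional w p.
  move=> [[wl _ _] _] [[pl _ _] pb].
  exact: (product_functional_klein u alpha_grading beta_grading).
split.
- move=> psi psiX.
  exact: even_product_state_comp (And4 kappa_lin kM k1 kS) jXl kj pfE psiX.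
- move=> psi phi _ _ pk; apply/funext => x.
  by rewrite -(kinvK x); exact: (congr1 (@^~ (kinv x)) pk).
move=> psi psiF; exists (psi \o kinv).
  exact: even_product_state_comp kM' (completion_linear F_fermi) kinvj pfE psiF.
by apply/funext => x /=; rewrite kappaK.
Qed.
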